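(* Let $n\ge2$ and let $g$ be the left-invariant Hermitian metric on $\mathsf{SL}_{n+1}(\mathbb C)$ induced by the inner product $\langle\sigma_{x_0,y_0,z_0}\cdot,\cdot\rangle$ on $\mathfrak{sl}_{n+1}(\mathbb C)$ for some $x_0,y_0,z_0>0$. Then the unique left-invariant solution $(g_t)_{t\in[0,T_{\max})}$ of the Positive Hermitian Curvature Flow with $g_0=g$ is induced by $\langle\sigma_{x(t),y(t),z(t)}\cdot,\cdot\rangle$, where $(x,y,z):[0,T_{\max})\to\mathbb R^3_{>0}$ is a smooth solution of \[\dot x=nx^2+z^2,\quad \dot y=(n+1)z^2,\quad \dot z=\tfrac{n+1}{n}z\big((n-1)x+y\big),\qquad (x,y,z)(0)=(x_0,y_0,z_0).\]
   Context: $\langle X,Y\rangle=\operatorname{tr}(XY^* )$ on $\mathfrak{sl}_{n+1}(\mathbb C)$; $\mathfrak{sl}_n(\mathbb C)$ is embedded as the upper-left block, $I=\sqrt{\tfrac1{n(n+1)}}\operatorname{diag}(1,\dots,1,-n)$, $\mathfrak s=\operatorname{span}_{\mathbb C}\{e_{i(n+1)},e_{(n+1)i}\}_{i=1}^n$, and $\sigma_{x,y,z}=x^{-1}\mathrm{id}_{\mathfrak{sl}_n(\mathbb C)}+y^{-1}\mathrm{id}_{\mathbb CI}+z^{-1}\mathrm{id}_{\mathfrak s}$. The Positive Hermitian Curvature Flow is $\partial_tg_t=-\Theta(g_t)$, where for a left-invariant Hermitian metric $g$ on a complex Lie group $\Theta(g)=g(P\cdot,\cdot)$ with $P$ the $g_e$-Hermitian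 endomorphism of the Lie algebra satisfying $g_e(PX,X)=\sum_{i<j}|g_e([e_i,e_j],X)|^2$ for a $g_e$-unitary complex basis $\{e_i\}$. *)

(* Defs.v *)
(* Complex numbers: R[i] (mathcomp-real-closed). *)
From mathcomp Require Import all_boot all_algebra.
From mathcomp Require Import all_classical all_reals all_analysis.
From mathcomp Require Export complex.
Import GRing.Theory Num.Theory numFieldNormedType.Exports.

Set Implicit Arguments.
Unset Strict Implicit.
Unset Printing Implicit Defensive.

Local Open Scope ring_scope.
Local Open Scope complex_scope.
Local Open Scope classical_set_scope.

Section PHCF.
Variable R : realType.
Local Notation C := R[i].
Variable n : nat.

(* gl_{n+1}(C) as (n+1)x(n+1) complex matrices; the last index ord_max is
   the index n+1 of the paper. *)
Definition mat := 'M[C]_n.+1.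

(* membership in sl_{n+1}(C) *)
Definition in_sl (X : mat) : Prop := \tr X = 0.

(* conjugate transpose *)
Definition adjm (Y : mat) : mat := trmx (map_mx conjc Y).

(* <X,Y> = tr(X conj-transpose(Y)) *)
Definition ipsl (X Y : mat) : C := \tr (X *m adjm Y).

(* Lie bracket *)
Definition lie (X Y : mat) : mat := X *m Y - Y *m X.

(* I = sqrt(1/(n(n+1))) diag(1,...,1,-n) *)
Definition Imat : mat :=
  ((Num.sqrt (1 / (n%:R * (n.+1)%:R)) : R)%:C) *:
    \matrix_(i, j) (if i == j then (if i == ord_max then - n%:R else 1) else 0).

(* orthogonal projection onto C I *)
Definition pr_CI (X : mat) : mat := ipsl X Imat *: Imat.

(* projection onto s = span{e_{i(n+1)}, e_{(n+1)i}}, i <= n *)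
Definition pr_s (X : mat) : mat :=
  \matrix_(i, j) (if (i == ord_max) (+) (j == ord_max) then X i j else 0).

(* projection onto sl_n(C) (upper-left block), for X in sl_{n+1} *)
Definition pr_sln (X : mat) : mat := X - pr_CI X - pr_s X.

(* sigma_{x,y,z} = x^{-1} id_{sl_n} + y^{-1} id_{CI} + z^{-1} id_s *)
Definition sigma (x y z : R) (X : mat) : mat :=
  (x^-1)%:C *: pr_sln X + (y^-1)%:C *: pr_CI X + (z^-1)%:C *: pr_s X.

(* a Hermitian inner product on sl_{n+1}(C) (complex linear in the first
   argument, conjugate-symmetric, positive definite) *)
Definition herm_ip (h : mat -> mat -> C) : Prop :=
  [/\ (forall (a : C) X Y Z, in_sl X -> in_sl Y -> in_sl Z ->
          h (a *: X + Y) Z = a * h X Z + h Y Z),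
      (forall X Y, in_sl X -> in_sl Y -> h Y X = (h X Y)^*) &
      (forall X, in_sl X -> X != 0 -> 0 < h X X)].

(* dimension of sl_{n+1}(C) over C *)
Definition dim_sl : nat := (n.+1 * n.+1).-1.

(* an h-unitary basis of sl_{n+1}(C): dim_sl orthonormal elements of sl_{n+1} *)
Definition unitary_basis (h : mat -> mat -> C) (e : 'I_dim_sl -> mat) : Prop :=
  (forall i, in_sl (e i)) /\
  (forall i j, h (e i) (e j) = (if i == j then 1 else 0)).

(* Theta(g)(X,Y) = g(PX,Y), where g(PX,X) = sum_{i<j} |g([e_i,e_j],X)|^2;
   the unique sesquilinear form with these diagonal values is
   sum_{i<j} g(X,[e_i,e_j]) g([e_i,e_j],Y). *)
Definition Theta (h : mat -> mat -> C) (e : 'I_dim_sl -> mat) (X Y : mat) : C :=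
  \sum_(i < dim_sl) \sum_(j < dim_sl | (i < j)%N)
     h X (lie (e i) (e j)) * h (lie (e i) (e j)) Y.

(* real and imaginary parts of t |-> h_t(X,Y) *)
Definition hRe (h : R -> mat -> mat -> C) (X Y : mat) : R -> R :=
  fun s => complex.Re (h s X Y).
Definition hIm (h : R -> mat -> mat -> C) (X Y : mat) : R -> R :=
  fun s => complex.Im (h s X Y).

(* (h_t)_{t in [0,T)} is a (left-invariant) solution of the Positive Hermitian
   Curvature Flow  d/dt h_t = - Theta(h_t)  with initial value h0. *)
Definition PHCF_solution (T : R) (h0 : mat -> mat -> C)
    (h : R -> mat -> mat -> C) : Prop :=
  [/\ (forall t, 0 <= t < T -> herm_ip (h t)),
      (forall X Y, in_sl X -> in_sl Y -> h 0 X Y = h0 X Y),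
      (forall X Y, in_sl X -> in_sl Y ->
         {within `[0, T[, continuous (hRe h X Y)} /\
         {within `[0, T[, continuous (hIm h X Y)}) &
      (forall t, 0 < t < T -> exists e, unitary_basis (h t) e /\
         forall X Y, in_sl X -> in_sl Y ->
           is_derive t (1 : R) (hRe h X Y)
                     (complex.Re (- Theta (h t) e X Y)) /\
           is_derive t (1 : R) (hIm h X Y)
                     (complex.Im (- Theta (h t) e X Y)))].

(* (x,y,z) : [0,T) -> R^3_{>0} solves
   x' = n x^2 + z^2, y' = (n+1) z^2, z' = (n+1)/n z ((n-1) x + y),
   (x,y,z)(0) = (x0,y0,z0). *)
Definition xyz_solution (T x0 y0 z0 : R) (x y z : R -> R) : Prop :=
  [/\ (forall t, 0 <= t < T -> 0 < x t /\ 0 < y t /\ 0 < z t),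
      x 0 = x0 /\ y 0 = y0 /\ z 0 = z0,
      [/\ {within `[0, T[, continuous x}, {within `[0, T[, continuous y}
        & {within `[0, T[, continuous z}] &
      (forall t, 0 < t < T ->
         [/\ is_derive t (1 : R) x (n%:R * x t ^+ 2 + z t ^+ 2),
             is_derive t (1 : R) y ((n.+1)%:R * z t ^+ 2)
           & is_derive t (1 : R) z
               ((n.+1)%:R / n%:R * z t * ((n.-1)%:R * x t + y t))])].

End PHCF.

(* Main.v *)
From HB Require Import structures.
Require Import Defs.
From mathcomp Require Import all_boot all_order all_algebra.
From mathcomp Require Import all_classical all_reals all_analysis.
From mathcomp Require Import complex ring lra.
Import Order.TTheory GRing.Theory Num.Theory numFieldNormedType.Exports.

(** Extend a metric h on sl_{n+1}(C) to gl_{n+1}(C) by an orthogonal vector along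
the identity matrix, and let M be the inverse of its Gram matrix, i.e. the sum
of [conj(e_i)^T e_i] over a unitary basis. In terms of M the flow becomes the
quadratic equation M' = quad M M, with quad M M the sum over i < j of
[conj([e_i, e_j])^T [e_i, e_j]].

The metrics [sigma x y z] correspond to duals that, modulo the centre of
gl_{n+1}, are diagonal on the matrix units, with weights x on the upper-left
block, z on s and ((n+1) y - x) / n on the last diagonal unit. A direct
computation shows that quad maps this family to itself, with the weights of
the system for (x, y, z). Reading x, y, z off three entries of M gives a linear
projection onto the family, and the difference D between M and its projection
then satisfies a linear homogeneous equation with continuous coefficients;
since D(0) = 0, Gronwall's argument gives D = 0. No existence theorem for the
system in (x, y, z) is needed, the solution being read off from h. *)

Set Implicit Arguments.
Unset Strict Implicit.
Unset Printing Implicit Defensive.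

Local Open Scope ring_scope.
Local Open Scope classical_set_scope.
Local Open Scope complex_scope.

(** * Calculus of complex-valued curves through their real and imaginary parts *)

Section ComplexCurves.
Context {R : realType}.
Local Notation C := R[i].
Implicit Types (f g : R -> C) (t T : R).

Definition is_deriveC t f (df : C) : Prop :=
  is_derive t (1 : R) (fun s => complex.Re (f s)) (complex.Re df) /\
  is_derive t (1 : R) (fun s => complex.Im (f s)) (complex.Im df).

Definition continuousC T f : Prop :=
  {within `[0, T[, continuous (fun s => complex.Re (f s))} /\
  {within `[0, T[, continuous (fun s => complex.Im (f s))}.

Lemma Re_addc (x y : C) : complex.Re (x + y) = complex.Re x + complex.Re y.
Proof. by case: x; case: y. Qed.
Lemma Im_addc (x y : C) : complex.Im (x + y) = complex.Im x + complex.Im y.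
Proof. by case: x; case: y. Qed.
Lemma Re_mulc (x y : C) :
  complex.Re (x * y) = complex.Re x * complex.Re y - complex.Im x * complex.Im y.
Proof. by case: x; case: y. Qed.
Lemma Im_mulc (x y : C) :
  complex.Im (x * y) = complex.Re x * complex.Im y + complex.Im x * complex.Re y.
Proof. by case: x => a b; case: y. Qed.
Lemma Re_invc (x : C) :
  complex.Re x^-1 = complex.Re x * (complex.Re x ^+ 2 + complex.Im x ^+ 2)^-1.
Proof. by case: x. Qed.
Lemma Im_invc (x : C) :
  complex.Im x^-1 = - (complex.Im x * (complex.Re x ^+ 2 + complex.Im x ^+ 2)^-1).
Proof. by case: x. Qed.

Lemma Re2Im2_neq0 (x : C) :
  x != 0 -> complex.Re x ^+ 2 + complex.Im x ^+ 2 != 0.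
Proof.
case: x => a b; apply: contraNneq => /= h.
have [ha hb] : a = 0 /\ b = 0 by split; nra.
by rewrite ha hb.
Qed.

Lemma is_deriveC_cst t (c : C) : is_deriveC t (fun=> c) 0.
Proof. by split; exact: is_derive_cst. Qed.

Lemma is_deriveCD t f g df dg : is_deriveC t f df -> is_deriveC t g dg ->
  is_deriveC t (fun s => f s + g s) (df + dg).
Proof.
move=> [fr fi] [gr gi]; split.
  under eq_fun do rewrite Re_addc.
  by rewrite Re_addc; exact: is_deriveD.
under eq_fun do rewrite Im_addc.
by rewrite Im_addc; exact: is_deriveD.
Qed.

Lemma is_deriveCM t f g df dg : is_deriveC t f df -> is_deriveC t g dg ->
  is_deriveC t (fun s => f s * g s) (df * g t + f t * dg).
Proof.
move=> [fr fi] [gr gi]; split.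
  under eq_fun do rewrite Re_mulc.
  apply: (is_derive_eq (is_deriveB (is_deriveM fr gr) (is_deriveM fi gi))).
  by rewrite Re_addc !Re_mulc /GRing.scale/=; ring.
under eq_fun do rewrite Im_mulc.
apply: (is_derive_eq (is_deriveD (is_deriveM fr gi) (is_deriveM fi gr))).
by rewrite Im_addc !Im_mulc /GRing.scale/=; ring.
Qed.

Lemma is_deriveC_sum t (I : Type) (r : seq I) (P : pred I)
    (f : I -> R -> C) (df : I -> C) :
  (forall i, is_deriveC t (f i) (df i)) ->
  is_deriveC t (fun s => \sum_(i <- r | P i) f i s) (\sum_(i <- r | P i) df i).
Proof.
move=> fd; elim: r => [|a r IH].
  under eq_fun do rewrite big_nil.
  by rewrite big_nil; exact: is_deriveC_cst.
under eq_fun do rewrite big_cons.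
by rewrite big_cons; case: ifP => // _; exact: is_deriveCD.
Qed.

Lemma is_deriveC_uniq t f df dg :
  is_deriveC t f df -> is_deriveC t f dg -> df = dg.
Proof.
case: df => a b; case: dg => c d [/= f1 f2] [/= f3 f4].
have e1 : a = c by rewrite -(@derive_val _ _ _ _ _ _ _ f1) (@derive_val _ _ _ _ _ _ _ f3).
have e2 : b = d by rewrite -(@derive_val _ _ _ _ _ _ _ f2) (@derive_val _ _ _ _ _ _ _ f4).
by rewrite e1 e2.
Qed.

(** The value of the derivative is left open: for the inverse Gram matrix it is identified only
    afterwards, from the equation expressing that it is an inverse. *)
Definition derivableC t f : Prop := exists df, is_deriveC t f df.

Lemma derivableCV t f : f t != 0 -> derivableC t f ->
  derivableC t (fun s => (f s)^-1).
Proof.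
move=> ft0 [df [fr fi]].
have n0 := @Re2Im2_neq0 _ ft0.
have dn : is_derive t (1 : R) (fun s => complex.Re (f s) ^+ 2 + complex.Im (f s) ^+ 2) _
  := is_deriveD (is_deriveX 2 fr) (is_deriveX 2 fi).
have dV := @is_deriveV R (fun s => complex.Re (f s) ^+ 2 + complex.Im (f s) ^+ 2)
  t _ 1 n0 dn.
eexists (Complex _ _); split => /=.
  under eq_fun do rewrite Re_invc.
  exact: (is_deriveM fr dV).
under eq_fun do rewrite Im_invc.
exact: (is_deriveN (is_deriveM fi dV)).
Qed.

Lemma continuousC_cst T (c : C) : continuousC T (fun=> c).
Proof. by split => x; exact: cst_continuous. Qed.

Lemma continuousCD T f g : continuousC T f -> continuousC T g ->
  continuousC T (fun s => f s + g s).
Proof.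
move=> [fr fi] [gr gi]; split.
  rewrite (funext (fun s => Re_addc (f s) (g s))).
  by move=> x; exact: (cvgD (fr x) (gr x)).
rewrite (funext (fun s => Im_addc (f s) (g s))).
by move=> x; exact: (cvgD (fi x) (gi x)).
Qed.

Lemma continuousCM T f g : continuousC T f -> continuousC T g ->
  continuousC T (fun s => f s * g s).
Proof.
move=> [fr fi] [gr gi]; split.
  rewrite (funext (fun s => Re_mulc (f s) (g s))).
  by move=> x; exact: (cvgB (cvgM (fr x) (gr x)) (cvgM (fi x) (gi x))).
rewrite (funext (fun s => Im_mulc (f s) (g s))).
by move=> x; exact: (cvgD (cvgM (fr x) (gi x)) (cvgM (fi x) (gr x))).
Qed.

Lemma continuousC_sum T (I : Type) (r : seq I) (P : pred I) (f : I -> R -> C) :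
  (forall i, continuousC T (f i)) ->
  continuousC T (fun s => \sum_(i <- r | P i) f i s).
Proof.
move=> fd; elim: r => [|a r IH].
  rewrite (_ : (fun s => _) = fun=> 0); last by apply/funext => s; rewrite big_nil.
  exact: continuousC_cst.
rewrite (_ : (fun s => _) = fun s => if P a then f a s + \sum_(i <- r | P i) f i s
  else \sum_(i <- r | P i) f i s); last by apply/funext => s; rewrite big_cons.
by case: (P a) => //; exact: continuousCD.
Qed.

Lemma continuousCV T f : (forall t, 0 <= t < T -> f t != 0) ->
  continuousC T f -> continuousC T (fun s => (f s)^-1).
Proof.
move=> f0 [fr fi].
(* [f] is known to be nonzero only on [0, T), so the reciprocal is treated point by point there;
   this suffices for continuity within the interval. *)
have H : {in `[0, T[%classic, continuous ((fun s =>
    (complex.Re (f s) ^+ 2 + complex.Im (f s) ^+ 2)^-1) : subspace `[0, T[ -> R)}.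
  move=> x; rewrite inE/= in_itv/= => xT.
  apply: cvgV; first by apply: Re2Im2_neq0; exact: f0.
  exact: (cvgD (cvgM (fr x) (fr x)) (cvgM (fi x) (fi x))).
split; rewrite continuous_subspace_in => x xT.
  rewrite (funext (fun s => Re_invc (f s))).
  exact: (cvgM (fr x) (H x xT)).
rewrite (funext (fun s => Im_invc (f s))).
exact: (cvgN (cvgM (fi x) (H x xT))).
Qed.

Section PolynomialClosure.
Variable P : (R -> C) -> Prop.
Hypothesis P_cst : forall c, P (fun=> c).
Hypothesis P_add : forall f g, P f -> P g -> P (fun s => f s + g s).
Hypothesis P_mul : forall f g, P f -> P g -> P (fun s => f s * g s).

(** Determinants and cofactors are polynomials in the entries, so they inherit every property of
    curves that is stable under constants, sums and products. Later [P] is continuity within [0, T)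
    or differentiability at a point. *)
Lemma det_closed m (A : R -> 'M[C]_m) :
  (forall i j, P (fun s => A s i j)) -> P (fun s => \det (A s)).
Proof.
move=> PA; rewrite /determinant.
have Pprod (p : 'I_m -> 'I_m) (r : seq 'I_m) :
    P (fun s => \prod_(i <- r) A s i (p i)).
  elim: r => [|a r IH].
    by under eq_fun do rewrite big_nil; exact: P_cst.
  by under eq_fun do rewrite big_cons; exact: P_mul.
elim: (index_enum _) => [|a r IH].
  by under eq_fun do rewrite big_nil; exact: P_cst.
under eq_fun do rewrite big_cons.
by apply: P_add => //; apply: P_mul => //; exact: P_cst.
Qed.

Lemma adj_closed m (A : R -> 'M[C]_m) :
  (forall i j, P (fun s => A s i j)) ->
  forall i j, P (fun s => (\adj (A s)) i j).
Proof.
move=> PA i j; under eq_fun do rewrite mxE /cofactor.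
apply: P_mul; first exact: P_cst.
apply: det_closed => k l.
by under eq_fun do rewrite !mxE.
Qed.

End PolynomialClosure.

End ComplexCurves.

(** * Uniqueness for real linear homogeneous systems *)

Section LinearODE.
Context {R : realType}.

Lemma is_derive_bigsum t (I : Type) (r : seq I) (f : I -> R -> R) (df : I -> R) :
  (forall i, is_derive t (1 : R) (f i) (df i)) ->
  is_derive t (1 : R) (fun s => \sum_(i <- r) f i s) (\sum_(i <- r) df i).
Proof.
move=> fd; elim: r => [|a r IH].
  under eq_fun do rewrite big_nil.
  by rewrite big_nil; exact: is_derive_cst.
under eq_fun do rewrite big_cons.
by rewrite big_cons; exact: is_deriveD.
Qed.

Lemma within_continuous_bigsum (D : set R) (I : Type) (r : seq I)
    (f : I -> R -> R) :
  (forall i, {within D, continuous (f i)}) ->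
  {within D, continuous (fun s => \sum_(i <- r) f i s)}.
Proof.
move=> fd; elim: r => [|a r IH].
  rewrite (_ : (fun s => _) = fun=> 0); last by apply/funext => s; rewrite big_nil.
  by move=> x; exact: cst_continuous.
rewrite (_ : (fun s => _) = fun s => f a s + \sum_(i <- r) f i s); last first.
  by apply/funext => s; rewrite big_cons.
by move=> x; exact: (cvgD (fd a x) (IH x)).
Qed.

(** The difference of the two sides is half a combination of [(x + y) ^+ 2] and [(x - y) ^+ 2] with
    the nonnegative weights [c - a] and [c + a]. *)
Lemma double_prod_le (a c x y : R) : `|a| <= c ->
  2 * x * (a * y) <= c * (x ^+ 2 + y ^+ 2).
Proof.
rewrite ler_norml => /andP[ca ac]; rewrite -subr_ge0.
have -> : c * (x ^+ 2 + y ^+ 2) - 2 * x * (a * y) =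
  ((c - a) * (x + y) ^+ 2 + (c + a) * (x - y) ^+ 2) / 2 by field.
by rewrite divr_ge0 // addr_ge0 // mulr_ge0 ?sqr_ge0 //; lra.
Qed.

(** Gronwall's argument: the sum of squares [E] has derivative at most [b * E], so [F], which is [E]
    damped by the exponential of rate [b], does not increase. It vanishes at 0 and is nonnegative,
    hence is zero. *)
Lemma linear_ode_eq0 (K : finType) (T : R) (d : K -> R -> R)
    (A : K -> K -> R -> R) :
  (forall k, {within `[0, T[, continuous (d k)}) ->
  (forall k l, {within `[0, T[, continuous (A k l)}) ->
  (forall t, 0 < t < T -> forall k,
     is_derive t (1 : R) (d k) (\sum_l A k l t * d l t)) ->
  (forall k, d k 0 = 0) ->
  forall t, 0 <= t < T -> forall k, d k t = 0.
Proof.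
move=> cd cA dd d0 t /andP[t0 tT] k0.
have sub : `[0, t] `<=` `[0, T[.
  by move=> x /=; rewrite !in_itv/= => /andP[-> xt] /=; exact: le_lt_trans tT.
(* The coefficients need not be bounded on [0, T), but they are on the compact interval [0, t]: the
   maximum of the sum of their absolute values bounds each of them. *)
have [c Ac] : exists c, forall s, s \in `[0, t]%R -> forall k l, `|A k l s| <= c.
  have cG : {within `[0, t], continuous (fun s => \sum_k \sum_l `|A k l s|)}.
    apply: within_continuous_bigsum => k.
    apply: within_continuous_bigsum => l x.
    apply: cvg_norm; exact: (continuous_subspaceW sub (cA k l)).
  have [m _ mP] := EVT_max t0 cG.
  exists (\sum_k \sum_l `|A k l m|) => s st k l.
  apply: le_trans (mP s st).
  rewrite (bigD1 k) //= (bigD1 l) //= -addrA lerDl addr_ge0 //.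
    by apply: sumr_ge0.
  by apply: sumr_ge0 => i _; apply: sumr_ge0.
pose E s := \sum_k d k s ^+ 2.
pose b := 2 * c * #|K|%:R.
pose F s := E s * expR (- (b * s)).
have de s : is_derive s (1 : R) (fun u => expR (- (b * u))) (- b * expR (- (b * s))).
  have di : is_derive s (1 : R) (fun u => - (b * u)) (- b).
    apply: (is_derive_eq (is_deriveN (is_deriveZ b (is_derive_id s (1 : R))))).
    by rewrite /GRing.scale/= mulr1.
  apply: (is_derive_eq (is_derive1_comp (is_derive_expR _) di)).
  by rewrite /GRing.scale/= mulrC.
have cF : {within `[0, t], continuous F}.
  apply: (continuous_subspaceW sub) => x.
  apply: cvgM.
    apply: within_continuous_bigsum => k y.
    exact: (cvgM (cd k y) (cd k y)).
  apply: continuous_subspaceT => y.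
  apply: differentiable_continuous; apply/derivable1_diffP.
  exact: (@ex_derive _ _ _ _ _ _ _ (de y)).
have dE s : 0 < s < T ->
    is_derive s (1 : R) E (\sum_k 2 * d k s * (\sum_l A k l s * d l s)).
  move=> sT; apply: is_derive_bigsum => k.
  apply: (is_derive_eq (is_deriveX 2 (dd s sT k))).
  by rewrite /GRing.scale/= expr1.
have dF s : 0 < s < T -> is_derive s (1 : R) F
   ((\sum_k 2 * d k s * (\sum_l A k l s * d l s) - b * E s) * expR (- (b * s))).
  move=> sT.
  apply: (is_derive_eq (is_deriveM (dE s sT) (de s))).
  by rewrite /GRing.scale/=; ring.
have F0 : F 0 = 0.
  by rewrite /F /E big1 ?mul0r // => k _; rewrite d0 expr0n.
have Ft : F t <= F 0.
  apply: (@ler0_derive1_le_cc R F 0 t) => //.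
  - move=> s; rewrite in_itv/= => /andP[s0 st].
    by apply: (@ex_derive _ _ _ _ _ _ _ (dF s _)); rewrite s0 (lt_trans st).
  - move=> s; rewrite in_itv/= => /andP[s0 st].
    have sT : 0 < s < T by rewrite s0 (lt_trans st).
    rewrite derive1E (@derive_val _ _ _ _ _ _ _ (dF s sT)).
    rewrite pmulr_lle0 ?expR_gt0 // subr_le0.
    have {}st : s \in `[0, t]%R by rewrite in_itv/= !ltW.
    (* In the sum over all pairs each square occurs [2 * #|K|] times, whence the choice of [b]. *)
    have -> : b * E s = \sum_k \sum_l c * (d k s ^+ 2 + d l s ^+ 2).
      under eq_bigr => k _ do rewrite -mulr_sumr big_split/= sumr_const.
      by rewrite -mulr_sumr big_split/= sumr_const sumrMnl -/(E s) /b; ring.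
    apply: ler_sum => k _; rewrite mulr_sumr; apply: ler_sum => l _.
    by apply: double_prod_le; exact: Ac.
  - by rewrite in_itv/= t0 lexx.
  - by rewrite in_itv/= t0 lexx.
have : E t <= 0.
  by move: Ft; rewrite F0 /F pmulr_lle0 ?expR_gt0.
rewrite /E (bigD1 k0) //= => h.
have : d k0 t ^+ 2 <= 0.
  by apply: le_trans h; rewrite lerDl; apply: sumr_ge0 => i _; exact: sqr_ge0.
by rewrite le_eqVlt ltNge sqr_ge0 orbF sqrf_eq0 => /eqP.
Qed.

End LinearODE.

(** * The quadratic map induced by the Lie bracket, and its invariance modulo the centre *)

Section BracketForm.
Variables (R : realType) (n : nat).
Local Notation C := R[i].
Local Notation N := n.+1.
Local Notation m := (n.+1 * n.+1)%N.
Implicit Types (u v : 'rV[C]_m) (U V K : 'M[C]_m) (X Y Z : mat R n).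

Definition vec X : 'rV[C]_m := mxvec X.
Definition unvec u : mat R n := vec_mx u.

Lemma vecK : cancel vec unvec. Proof. exact: mxvecK. Qed.
Lemma unvecK : cancel unvec vec. Proof. exact: vec_mxK. Qed.

Definition bracket u v : 'rV[C]_m := vec (lie (unvec u) (unvec v)).

(** These vectors carry the structure constants of gl_{n+1} in the basis of matrix units. *)
Definition basis_bracket (a b : 'I_m) := bracket (delta_mx 0 a) (delta_mx 0 b).

Lemma bracketE u v :
  bracket u v = \sum_a \sum_b (u 0 a * v 0 b) *: basis_bracket a b.
Proof.
have lin1 w : linear (bracket ^~ w).
  move=> k x y; rewrite /bracket /lie /vec /unvec -linearP; congr mxvec.
  by rewrite linearP /= mulmxDl mulmxDr -scalemxAl -scalemxAr scalerBr opprD addrACA.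
have lin2 w : linear (bracket w).
  move=> k x y; rewrite /bracket /lie /vec /unvec -linearP; congr mxvec.
  by rewrite linearP /= mulmxDl mulmxDr -scalemxAl -scalemxAr scalerBr opprD addrACA.
pose l1 w := GRing.isLinear.Build _ _ _ _ (bracket ^~ w) (lin1 w).
pose l2 w := GRing.isLinear.Build _ _ _ _ (bracket w) (lin2 w).
pose L1 w : {linear 'rV[C]_m -> 'rV[C]_m} := HB.pack (bracket ^~ w) (l1 w).
pose L2 w : {linear 'rV[C]_m -> 'rV[C]_m} := HB.pack (bracket w) (l2 w).
rewrite {1}(row_sum_delta u) -[LHS]/(L1 v _) linear_sum; apply: eq_bigr => a _.
rewrite linearZ/= {1}(row_sum_delta v) -[bracket _ _]/(L2 (delta_mx 0 a) _).
rewrite linear_sum scaler_sumr; apply: eq_bigr => b _.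
by rewrite linearZ/= scalerA.
Qed.

(** The bilinear map sending the pair of rank-one matrices [u^T *m u'], [v^T *m v'] to half of
    [(bracket u v)^T *m bracket u' v']. The expansion in coordinates makes it visibly well defined
    and bilinear; the factor 1/2 turns a sum over all pairs of basis vectors into one over i < j. *)
Definition quad U V : 'M[C]_m :=
  \sum_a \sum_c U a c *: \sum_b \sum_d
    V b d *: (2^-1 *: ((basis_bracket a b)^T *m basis_bracket c d)).

Lemma quad_is_linear_l V : linear (quad ^~ V).
Proof.
move=> k U U'; rewrite /quad scaler_sumr -big_split/=; apply: eq_bigr => a _.
rewrite scaler_sumr -big_split/=; apply: eq_bigr => c _.
by rewrite !mxE scalerDl scalerA.
Qed.

Lemma quad_is_linear_r U : linear (quad U).
Proof.
move=> k V V'; rewrite /quad scaler_sumr -big_split/=; apply: eq_bigr => a _.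
rewrite scaler_sumr -big_split/=; apply: eq_bigr => c _.
rewrite [k *: (_ *: _)]scalerA [k * _]mulrC -[(_ * k) *: _]scalerA -scalerDr.
congr (_ *: _).
rewrite scaler_sumr -big_split/=; apply: eq_bigr => b _.
rewrite scaler_sumr -big_split/=; apply: eq_bigr => d _.
by rewrite [in LHS]mxE [in LHS]mxE scalerDl -[in LHS]scalerA.
Qed.

(** The arguments are swapped so that linearity in the first argument of [quad] can also be declared
    as an instance. *)
Definition quadl V U := quad U V.
HB.instance Definition _ V :=
  GRing.isLinear.Build C 'M[C]_m 'M[C]_m _ (quadl V) (quad_is_linear_l V).
HB.instance Definition _ U :=
  GRing.isLinear.Build C 'M[C]_m 'M[C]_m _ (quad U) (quad_is_linear_r U).

Lemma quad_suml (I : Type) (r : seq I) (P : pred I) (F : I -> 'M[C]_m) V :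
  quad (\sum_(i <- r | P i) F i) V = \sum_(i <- r | P i) quad (F i) V.
Proof. exact: (linear_sum (quadl V)). Qed.

Lemma quad_sumr (I : Type) (r : seq I) (P : pred I) (F : I -> 'M[C]_m) U :
  quad U (\sum_(i <- r | P i) F i) = \sum_(i <- r | P i) quad U (F i).
Proof. exact: (linear_sum (quad U)). Qed.

Lemma quadZl k U V : quad (k *: U) V = k *: quad U V.
Proof. exact: (linearZ_LR (quadl V)). Qed.

Lemma quadZr k U V : quad U (k *: V) = k *: quad U V.
Proof. exact: (linearZ_LR (quad U)). Qed.

Lemma quadBl U U' V : quad (U - U') V = quad U V - quad U' V.
Proof. exact: (linearB (quadl V)). Qed.

Lemma quadBr U V V' : quad U (V - V') = quad U V - quad U V'.
Proof. exact: (linearB (quad U)). Qed.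

Lemma quad_rank1 u u' v v' : quad (u^T *m u') (v^T *m v') =
  2^-1 *: ((bracket u v)^T *m bracket u' v').
Proof.
rewrite (bracketE u v) (bracketE u' v') [(\sum_a _)^T]raddf_sum/= mulmx_suml scaler_sumr.
apply: eq_bigr => a _.
rewrite [(\sum_b _)^T]raddf_sum/= mulmx_suml scaler_sumr.
under [LHS]eq_bigr do rewrite scaler_sumr.
rewrite exchange_big; apply: eq_bigr => b _ /=.
rewrite mulmx_sumr scaler_sumr; apply: eq_bigr => c _.
rewrite mulmx_sumr !scaler_sumr; apply: eq_bigr => d _.
rewrite [(_ *: _)^T]linearZ/= -scalemxAl -scalemxAr !scalerA; congr (_ *: _).
by rewrite !mxE !big_ord1 !mxE; ring.
Qed.

Definition one_vec : 'rV[C]_m := vec 1%:M.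
(** The projection onto trace-zero matrices along the identity matrix, acting on row vectors from
    the right; [N] is the dot product of [one_vec] with itself. *)
Definition traceless : 'M[C]_m := 1%:M - N%:R^-1 *: (one_vec^T *m one_vec).

Lemma traceless_tr : traceless^T = traceless.
Proof. by rewrite linearB/= trmx1 linearZ/= trmx_mul trmxK. Qed.

Lemma dotE X Y : (vec X *m (vec Y)^T) 0 0 = \sum_i \sum_j X i j * Y i j.
Proof.
rewrite mxE pair_big/= (reindex _ (curry_mxvec_bij _ _))/=.
by apply: eq_bigr => -[i j] _ /=; rewrite mxE !mxvecE.
Qed.

Lemma dot1 X : (vec X *m one_vec^T) 0 0 = \tr X.
Proof.
rewrite dotE; apply: eq_bigr => i _; rewrite (bigD1 i)//= big1 ?addr0 => [|j ji].
  by rewrite mxE eqxx mulr1.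
by rewrite mxE eq_sym (negPf ji) mulr0.
Qed.

Lemma mul_traceless u :
  u *m traceless = u - (N%:R^-1 * \tr (unvec u)) *: one_vec.
Proof.
rewrite mulmxBr mulmx1 -scalemxAr mulmxA [u *m _]mx11_scalar mul_scalar_mx.
by rewrite -{2}(unvecK u) dot1 scalerA.
Qed.

Lemma unvec_traceless u :
  unvec (u *m traceless) = unvec u - (N%:R^-1 * \tr (unvec u))%:M.
Proof.
rewrite mul_traceless /unvec linearB linearZ/= mxvecK.
by rewrite -mul_scalar_mx mulmx1.
Qed.

Lemma tr_unvec_traceless u : \tr (unvec (u *m traceless)) = 0.
Proof.
rewrite unvec_traceless linearB/= mxtrace_scalar -[(_ * _) *+ _]mulr_natl mulrA.
by rewrite mulfV ?pnatr_eq0 // mul1r subrr.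
Qed.

Lemma traceless_id u : \tr (unvec u) = 0 -> u *m traceless = u.
Proof. by move=> u0; rewrite mul_traceless u0 mulr0 scale0r subr0. Qed.

Lemma lie_scalarl X (c : C) : lie (c%:M : mat R n) X = 0.
Proof. by rewrite /lie mul_scalar_mx mul_mx_scalar subrr. Qed.
Lemma lie_scalarr X (c : C) : lie X (c%:M : mat R n) = 0.
Proof. by rewrite /lie mul_scalar_mx mul_mx_scalar subrr. Qed.

Lemma lieBl X Y Z : lie (X - Y) Z = lie X Z - lie Y Z.
Proof.
by rewrite /lie mulmxBl mulmxBr !opprB addrACA [RHS]addrACA [- _ - _ in RHS]addrC.
Qed.
Lemma lieBr X Y Z : lie X (Y - Z) = lie X Y - lie X Z.
Proof.
by rewrite /lie mulmxBl mulmxBr !opprB addrACA [RHS]addrACA [- _ - _ in RHS]addrC.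
Qed.

Lemma bracket_tracelessl u v : bracket (u *m traceless) v = bracket u v.
Proof. by rewrite /bracket unvec_traceless lieBl lie_scalarl subr0. Qed.
Lemma bracket_tracelessr u v : bracket u (v *m traceless) = bracket u v.
Proof. by rewrite /bracket unvec_traceless lieBr lie_scalarr subr0. Qed.

(** Rank-one matrices span: each matrix unit is a product of a column and a row. *)
Lemma bilinear_mx_eq (f g : 'M[C]_m -> 'M[C]_m -> 'M[C]_m) :
  (forall V, linear (f ^~ V)) -> (forall U, linear (f U)) ->
  (forall V, linear (g ^~ V)) -> (forall U, linear (g U)) ->
  (forall u u' v v', f (u^T *m u') (v^T *m v') = g (u^T *m u') (v^T *m v')) ->
  forall U V, f U V = g U V.
Proof.
move=> f1 f2 g1 g2 fg U V.
have ext (F G : 'M[C]_m -> 'M[C]_m) : linear F -> linear G ->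
    (forall u u' : 'rV[C]_m, F (u^T *m u') = G (u^T *m u')) -> F =1 G.
  move=> lF lG FG W.
  pose LF := GRing.isLinear.Build _ _ _ _ F lF.
  pose LG := GRing.isLinear.Build _ _ _ _ G lG.
  pose F' : {linear 'M[C]_m -> 'M[C]_m} := HB.pack F LF.
  pose G' : {linear 'M[C]_m -> 'M[C]_m} := HB.pack G LG.
  rewrite (matrix_sum_delta W) -[LHS]/(F' _) -[RHS]/(G' _) !linear_sum.
  apply: eq_bigr => i _; rewrite !linear_sum; apply: eq_bigr => j _.
  rewrite !linearZ/=; congr (_ *: _).
  by have := FG (delta_mx 0 i) (delta_mx 0 j); rewrite trmx_delta mul_delta_mx.
apply: (ext (f U) (g U)) => // v v'.
by apply: (ext (f ^~ (v^T *m v')) (g ^~ (v^T *m v'))).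
Qed.

(** Scalar matrices are central, so brackets ignore the component along the identity. By bilinearity
    it is enough to see this on rank-one matrices. *)
Lemma quad_tracelessl U V : quad (traceless *m U *m traceless) V = quad U V.
Proof.
apply: (@bilinear_mx_eq (fun U V => quad (traceless *m U *m traceless) V) quad).
- move=> W k A A' /=; rewrite -quad_is_linear_l; congr quad.
  by move: traceless => P; rewrite mulmxDr mulmxDl -scalemxAr -scalemxAl.
- by move=> W; exact: quad_is_linear_r.
- exact: quad_is_linear_l.
- exact: quad_is_linear_r.
move=> u u' v v'; rewrite mulmxA -mulmxA -{1}traceless_tr -trmx_mul !quad_rank1.
by rewrite !bracket_tracelessl.
Qed.

Lemma quad_tracelessr U V : quad U (traceless *m V *m traceless) = quad U V.
Proof.
apply: (@bilinear_mx_eq (fun U V => quad U (traceless *m V *m traceless)) quad).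
- by move=> W; exact: quad_is_linear_l.
- move=> W k A A' /=; rewrite -quad_is_linear_r; congr quad.
  by move: traceless => P; rewrite mulmxDr mulmxDl -scalemxAr -scalemxAl.
- exact: quad_is_linear_l.
- exact: quad_is_linear_r.
move=> u u' v v'; rewrite mulmxA -mulmxA -{1}traceless_tr -trmx_mul !quad_rank1.
by rewrite !bracket_tracelessr.
Qed.

End BracketForm.

(** * Forms diagonal on the matrix units, constant on blocks, and their image under [quad] *)

Section BlockForms.
Variables (R : realType) (n : nat).
Local Notation C := R[i].
Local Notation N := n.+1.
Local Notation m := (n.+1 * n.+1)%N.
Implicit Types (u v : 'rV[C]_m) (U V K : 'M[C]_m) (X Y Z : mat R n).
Implicit Types (c : bool -> bool -> C).

(** No conjugate is taken, so this is bilinear in [X] and [Y]; for the dual metrics the conjugate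
    sits inside [K]. *)
Definition bil X Y K : C := (vec X *m K *m (vec Y)^T) 0 0.

Lemma bil_is_scalar X Y : scalar (bil X Y).
Proof.
by move=> k K K'; rewrite /bil mulmxDr mulmxDl -scalemxAr -scalemxAl !mxE.
Qed.
HB.instance Definition _ X Y :=
  GRing.isLinear.Build C 'M[C]_m C _ (bil X Y) (bil_is_scalar X Y).

Lemma bil_rank1 X Y Z Z' : bil X Y ((vec Z)^T *m vec Z') =
  (\sum_i \sum_j X i j * Z i j) * (\sum_i \sum_j Z' i j * Y i j).
Proof.
by rewrite /bil mulmxA -mulmxA mxE big_ord1 !dotE.
Qed.

Lemma dot_delta X (i j : 'I_N) :
  \sum_k \sum_l X k l * (delta_mx i j : mat R n) k l = X i j.
Proof.
rewrite (bigD1 i)//= [X in _ + X]big1 => [|k ki]; last first.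
  by rewrite big1 // => l _; rewrite mxE (negPf ki) mulr0.
rewrite addr0 (bigD1 j)//= [X in _ + X]big1 => [|l lj]; last first.
  by rewrite mxE (negPf lj) andbF mulr0.
by rewrite mxE !eqxx mulr1 !addr0.
Qed.

Lemma dot_lie_delta X (i j k l : 'I_N) :
  \sum_a \sum_b X a b * (lie (delta_mx i j : mat R n) (delta_mx k l)) a b =
  X i l *+ (j == k) - X k j *+ (l == i).
Proof.
rewrite /lie !mul_delta_mx_cond.
transitivity (\sum_a \sum_b (X a b * (delta_mx i l : mat R n) a b *+ (j == k)
   - X a b * (delta_mx k j : mat R n) a b *+ (l == i))).
  apply: eq_bigr => a _; apply: eq_bigr => b _.
  by rewrite mxE [X in _ + X]mxE !mulmxnE mulrBr !mulrnAr.
under eq_bigr do rewrite sumrB.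
rewrite sumrB; congr (_ - _).
  by under eq_bigr do rewrite sumrMnl; rewrite sumrMnl dot_delta.
by under eq_bigr do rewrite sumrMnl; rewrite sumrMnl dot_delta.
Qed.

Local Notation coef c i j := (c (i == @ord_max n) (j == @ord_max n)).

(** The two booleans tell whether the row index and the column index are the last one, so [c]
    assigns one weight to each of the four blocks. *)
Definition block_form c X Y : C :=
  \sum_(i < N) \sum_(j < N) coef c i j * (X i j * Y i j).

Definition block_mat c : 'M[C]_m := \sum_(i < N) \sum_(j < N)
  coef c i j *: ((vec (delta_mx i j))^T *m vec (delta_mx i j)).

Lemma bil_block_mat c X Y : bil X Y (block_mat c) = block_form c X Y.
Proof.
rewrite /block_mat linear_sum; apply: eq_bigr => i _.
rewrite linear_sum; apply: eq_bigr => j _.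
rewrite linearZ/= bil_rank1 dot_delta; congr (_ * (_ * _)).
by under eq_bigr do under eq_bigr do rewrite mulrC; exact: dot_delta.
Qed.

Lemma sum_eq_l k (F : 'I_k -> C) j : \sum_i F i *+ (j == i) = F j.
Proof.
rewrite (bigD1 j)//= eqxx big1 ?addr0 // => i ij.
by rewrite eq_sym (negPf ij) mulr0n.
Qed.

Lemma sum_eq_r k (F : 'I_k -> C) j : \sum_i F i *+ (i == j) = F j.
Proof. by under eq_bigr do rewrite eq_sym; exact: sum_eq_l. Qed.

(** The bracket of two matrix units is a difference of at most two matrix units. In the product of
    two such differences, the two square terms agree after relabelling and give the first sum; the
    cross terms survive only on diagonal entries and give the second. *)
Lemma bil_quad_block_mat c X Y :
  bil X Y (quad (block_mat c) (block_mat c)) =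
  \sum_i \sum_l (\sum_j coef c i j * coef c j l) * (X i l * Y i l) -
  \sum_i \sum_j (coef c i j * coef c j i) * (X i i * Y j j).
Proof.
have -> : bil X Y (quad (block_mat c) (block_mat c)) =
  \sum_i \sum_j \sum_k \sum_l 2^-1 * (coef c i j * coef c k l *
   ((X i l *+ (j == k) - X k j *+ (l == i)) *
    (Y i l *+ (j == k) - Y k j *+ (l == i)))).
  rewrite {1}/block_mat quad_suml linear_sum; apply: eq_bigr => i _.
  rewrite quad_suml linear_sum; apply: eq_bigr => j _.
  rewrite quadZl linearZ/= /block_mat quad_sumr linear_sum mulr_sumr.
  apply: eq_bigr => k _; rewrite quad_sumr linear_sum mulr_sumr.
  apply: eq_bigr => l _; rewrite quadZr linearZ/= quad_rank1 linearZ/= /bracket !vecK.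
  rewrite bil_rank1.
  rewrite dot_lie_delta.
  under [X in _ * (_ * (_ * (_ * X)))]eq_bigr do
    under eq_bigr do rewrite mulrC.
  by rewrite dot_lie_delta; ring.
set P := \sum_i \sum_l _ * (X i l * Y i l); set Q := \sum_i \sum_j _ * (_ * _).
pose T1 i j k l := 2^-1 * (coef c i j * coef c k l * (X i l * Y i l)).
pose T2 i j k l := 2^-1 * (coef c i j * coef c k l * (X k j * Y k j)).
pose T3 i j k l := 2^-1 * (coef c i j * coef c k l * (X i l * Y k j + X k j * Y i l)).
transitivity (\sum_i \sum_j \sum_k \sum_l (T1 i j k l *+ (j == k) +
    T2 i j k l *+ (l == i) - T3 i j k l *+ (l == i) *+ (j == k))).
  apply: eq_bigr => i _; apply: eq_bigr => j _; apply: eq_bigr => k _.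
  apply: eq_bigr => l _; rewrite /T1 /T2 /T3.
  by case: (j == k); case: (l == i); rewrite /= ?mulr0n ?mulr1n; ring.
have E1 : \sum_i \sum_j \sum_k \sum_l T1 i j k l *+ (j == k) = 2^-1 * P.
  rewrite mulr_sumr; apply: eq_bigr => i _.
  under eq_bigr => j _.
    under eq_bigr do rewrite sumrMnl.
    rewrite sum_eq_l; over.
  rewrite exchange_big mulr_sumr; apply: eq_bigr => l _ /=.
  by rewrite mulr_suml mulr_sumr; apply: eq_bigr.
have E2 : \sum_i \sum_j \sum_k \sum_l T2 i j k l *+ (l == i) = 2^-1 * P.
  under eq_bigr do under eq_bigr do under eq_bigr do rewrite sum_eq_r.
  under eq_bigr do rewrite exchange_big.
  rewrite exchange_big mulr_sumr; apply: eq_bigr => k _ /=.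
  rewrite exchange_big mulr_sumr; apply: eq_bigr => j _ /=.
  rewrite mulr_suml mulr_sumr; apply: eq_bigr => i _.
  by rewrite /T2 [coef c i j * _]mulrC.
have E3 : \sum_i \sum_j \sum_k \sum_l T3 i j k l *+ (l == i) *+ (j == k) = Q.
  (* The cross terms contain the diagonal entries in both orders, so [Q] is averaged with its copy
     under the exchange of [i] and [j]. *)
  have -> : Q = 2^-1 * (Q + \sum_i \sum_j coef c i j * coef c j i * (X j j * Y i i)).
    rewrite exchange_big/= /Q.
    under [X in _ = _ * (_ + X)]eq_bigr do under eq_bigr do rewrite [coef c _ _ * _]mulrC.
    by field.
  rewrite /Q -big_split mulr_sumr; apply: eq_bigr => i _ /=.
  rewrite -big_split mulr_sumr; apply: eq_bigr => j _ /=.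
  under eq_bigr do rewrite sumrMnl sum_eq_r.
  by rewrite sum_eq_l /T3 -mulrDr.
under eq_bigr do under eq_bigr do under eq_bigr do rewrite sumrB big_split/=.
under eq_bigr do under eq_bigr do rewrite sumrB big_split/=.
under eq_bigr do rewrite sumrB big_split/=.
rewrite sumrB big_split/= E1 E2 E3.
by field.
Qed.

Local Notation w := (widen_ord (leqnSn n)).

Lemma widen_neq_max (i : 'I_n) : (w i == ord_max) = false.
Proof. by apply/negbTE; rewrite -val_eqE/= neq_ltn ltn_ord. Qed.

Lemma sum_blocks c (G : 'I_N -> 'I_N -> C) :
  \sum_(i < N) \sum_(j < N) coef c i j * G i j =
  c false false * (\sum_(i < n) \sum_(j < n) G (w i) (w j)) +
  c false true * (\sum_(i < n) G (w i) ord_max) +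
  c true false * (\sum_(j < n) G ord_max (w j)) +
  c true true * G ord_max ord_max.
Proof.
have wF := widen_neq_max.
rewrite big_ord_recr/= eqxx big_ord_recr/= eqxx !mulr_sumr addrA.
congr (_ + _ + _); last by apply: eq_bigr => j _; rewrite wF.
rewrite -big_split/=; apply: eq_bigr => i _; rewrite big_ord_recr/= eqxx wF.
by rewrite mulr_sumr; congr (_ + _); apply: eq_bigr => j _; rewrite wF.
Qed.

Lemma tr_blocks X : \tr X = \sum_(i < n) X (w i) (w i) + X ord_max ord_max.
Proof. by rewrite /mxtrace big_ord_recr. Qed.

Lemma sum_widen_diag X : in_sl X ->
  \sum_(i < n) X (w i) (w i) = - X ord_max ord_max.
Proof. by move=> Xsl; apply/eqP; rewrite -addr_eq0 -tr_blocks; apply/eqP. Qed.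

(* The dual of the metric [sigma x y z], read modulo the centre of gl_{n+1}:
   modulo the identity matrix, [Imat] is a multiple of the last
   diagonal matrix unit, so that the form becomes diagonal on matrix units. *)
Definition weight (x y z : C) (a b : bool) : C :=
  if a then (if b then (N%:R * y - x) / n%:R else z)
  else (if b then z else x).

(** This is where the system for [x], [y], [z] arises. For trace-zero matrices the first [n]
    diagonal entries sum to minus the last one, so the second sum of [bil_quad_block_mat] is a
    multiple of the product of the last diagonal entries and only alters the last weight. *)
Lemma quad_weight (x y z : C) X Y : (0 < n)%N -> in_sl X -> in_sl Y ->
  bil X Y (quad (block_mat (weight x y z)) (block_mat (weight x y z))) =
  block_form (weight (n%:R * x ^+ 2 + z ^+ 2) (N%:R * z ^+ 2)
    (N%:R / n%:R * z * (n.-1%:R * x + y))) X Y.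
Proof.
move=> n0 Xsl Ysl; set c := weight x y z.
have nn0 : n%:R != 0 :> C by rewrite pnatr_eq0 -lt0n.
rewrite bil_quad_block_mat.
(* The square of the matrix of weights, again constant on blocks: the summation index takes [n]
   values other than the last, and the last one. *)
pose g a b := n%:R * (c a false * c false b) + c a true * c true b.
have gE (i l : 'I_N) : \sum_j coef c i j * coef c j l = coef g i l.
  rewrite big_ord_recr/= eqxx /g; congr (_ + _).
  under eq_bigr do rewrite widen_neq_max.
  by rewrite sumr_const card_ord mulr_natl.
under eq_bigr do under eq_bigr do rewrite gE.
rewrite (sum_blocks g) (sum_blocks (fun a b => c a b * c b a) (fun i j => X i i * Y j j)).
rewrite /block_form sum_blocks.
under [X in _ - (_ * X + _ + _ + _)]eq_bigr do rewrite -mulr_sumr.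
rewrite -!mulr_suml -!mulr_sumr (sum_widen_diag Xsl) (sum_widen_diag Ysl) /g /c /weight.
have -> : n.-1%:R = n%:R - 1 :> C by rewrite -[n in RHS](prednK n0) -natr1 addrK.
rewrite -[N%:R]natr1.
by field.
Qed.

End BlockForms.

(** * The operators [sigma] in matrix entries, and the forms dual to them *)

Section Sigma.
Variables (R : realType) (n : nat).
Local Notation C := R[i].
Local Notation N := n.+1.
Local Notation w := (widen_ord (leqnSn n)).
Implicit Types (X Y Z : mat R n).
Hypothesis n_gt0 : (0 < n)%N.

Let nn0 : n%:R != 0 :> C. Proof. by rewrite pnatr_eq0 -lt0n. Qed.
Let n1 : (n%:R + 1) != 0 :> C. Proof. by rewrite natr1 pnatr_eq0. Qed.

Lemma max_or_widen (i : 'I_N) : i = ord_max \/ exists j, i = w j.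
Proof.
have [lt_in|ni] := ltnP i n; [right; exists (Ordinal lt_in)|left]; apply: val_inj => //=.
by apply/eqP; rewrite eqn_leq ni -ltnS ltn_ord.
Qed.

Lemma eq_blocks X Y :
  (forall i j : 'I_n, X (w i) (w j) = Y (w i) (w j)) ->
  (forall i : 'I_n, X (w i) ord_max = Y (w i) ord_max) ->
  (forall j : 'I_n, X ord_max (w j) = Y ord_max (w j)) ->
  X ord_max ord_max = Y ord_max ord_max -> X = Y.
Proof.
move=> h1 h2 h3 h4; apply/matrixP => i j.
by case: (max_or_widen i) => [->|[k ->]]; case: (max_or_widen j) => [->|[l ->]].
Qed.

Lemma widen_eq (i j : 'I_n) : (w i == w j) = (i == j).
Proof. by []. Qed.

Definition kappa : C := (Num.sqrt (1 / (n%:R * N%:R)) : R)%:C.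

Lemma kappa2 : kappa ^+ 2 = (n%:R * N%:R)^-1.
Proof.
rewrite /kappa -rmorphXn/= sqr_sqrtr; last by rewrite divr_ge0 // mulr_ge0.
by rewrite div1r rmorphV ?unitfE ?mulf_neq0 ?pnatr_eq0 -?lt0n // rmorphM !rmorph_nat.
Qed.

Lemma ImatE i j : Imat R n i j =
  kappa * (if i == j then (if i == ord_max then - n%:R else 1) else 0).
Proof. by rewrite !mxE. Qed.

Lemma conj_Imat i j : conjc (Imat R n i j) = Imat R n i j.
Proof.
rewrite ImatE rmorphM; congr (_ * _); first exact: conjc_real.
case: eqP => _; rewrite ?rmorph0 //.
by case: eqP => _; rewrite ?rmorphN ?rmorph_nat ?rmorph1.
Qed.

Lemma ipslE X Y : ipsl X Y = \sum_i \sum_j X i j * conjc (Y i j).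
Proof.
by apply: eq_bigr => i _; rewrite mxE; apply: eq_bigr => j _; rewrite !mxE.
Qed.

Lemma sum_diag_blocks (d e : C) (G : 'I_N -> 'I_N -> C) :
  \sum_i \sum_j G i j * (if i == j then (if i == ord_max then d else e) else 0) =
  e * (\sum_(i < n) G (w i) (w i)) + d * G ord_max ord_max.
Proof.
have E i : \sum_j G i j * (if i == j then (if i == ord_max then d else e) else 0) =
    (if i == ord_max then d else e) * G i i.
  rewrite (bigD1 i)//= eqxx big1 ?addr0 1?mulrC // => j ji.
  by rewrite eq_sym (negPf ji) mulr0.
under eq_bigr do rewrite E.
rewrite big_ord_recr/= eqxx mulr_sumr; congr (_ + _).
by apply: eq_bigr => i _; rewrite widen_neq_max.
Qed.

Lemma in_sl_Imat : in_sl (Imat R n).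
Proof.
rewrite /in_sl tr_blocks ImatE !eqxx.
under eq_bigr do rewrite ImatE eqxx widen_neq_max.
by rewrite sumr_const card_ord -[_ *+ n]mulr_natr; ring.
Qed.

(** The weight of the last diagonal unit is chosen for this: the contribution of [x] from the first
    [n] diagonal entries cancels, so the unit vector [Imat] reads off [y]. *)
Lemma block_form_Imat (x y z : C) :
  block_form (weight n x y z) (Imat R n) (Imat R n) = y.
Proof.
rewrite /block_form sum_blocks.
rewrite [X in _ + _ * X + _ + _]big1; last first.
  by move=> i _; rewrite ImatE widen_neq_max mulr0 mul0r.
rewrite [X in _ + _ * X + _]big1; last first.
  by move=> i _; rewrite ImatE eq_sym widen_neq_max mulr0 mul0r.
have -> : \sum_(i < n) \sum_(j < n) Imat R n (w i) (w j) * Imat R n (w i) (w j)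
    = n%:R * kappa ^+ 2.
  rewrite mulr_natl -[in RHS](card_ord n) -sumr_const.
  apply: eq_bigr => i _; rewrite (bigD1 i)//= big1 ?addr0 => [|j ji].
    by rewrite ImatE eqxx widen_neq_max mulr1.
  by rewrite ImatE widen_eq eq_sym (negPf ji) mulr0 mul0r.
rewrite ImatE !eqxx /weight.
have -> : kappa * - n%:R * (kappa * - n%:R) = n%:R ^+ 2 * kappa ^+ 2 by ring.
by rewrite kappa2 -[N%:R]natr1; field; rewrite nn0 n1.
Qed.

(** For trace zero, the inner product of [X] with [Imat] depends on the last diagonal entry
    alone. *)
Lemma pr_CIE X i j : in_sl X -> pr_CI X i j =
  if i == j then (if i == ord_max then 1 else - n%:R^-1) * X ord_max ord_max else 0.
Proof.
move=> Xsl; rewrite mxE.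
have -> : ipsl X (Imat R n) = \sum_i \sum_j X i j * Imat R n i j.
  rewrite ipslE; apply: eq_bigr => k _; apply: eq_bigr => l _.
  by congr (_ * _); exact: conj_Imat.
under eq_bigr do under eq_bigr do rewrite ImatE mulrCA.
under eq_bigr do rewrite -mulr_sumr.
rewrite -mulr_sumr sum_diag_blocks mul1r ImatE (sum_widen_diag Xsl).
transitivity (kappa ^+ 2 * - (n%:R + 1) * X ord_max ord_max *
   (if i == j then if i == ord_max then - n%:R else 1 else 0)); first by ring.
rewrite kappa2 -[N%:R]natr1.
by case: eqP => _; rewrite ?mulr0 //; case: eqP => _; field; rewrite nn0 n1.
Qed.

Variables x y z : R.

Lemma sigmaE X i j : in_sl X -> sigma x y z X i j =
  if (i == ord_max) (+) (j == ord_max) then (z^-1)%:C * X i j else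
  (x^-1)%:C * (X i j - pr_CI X i j) + (y^-1)%:C * pr_CI X i j.
Proof.
move=> Xsl; rewrite /sigma /pr_sln.
have E : pr_s X i j = if (i == ord_max) (+) (j == ord_max) then X i j else 0.
  by rewrite mxE.
have := pr_CIE i j Xsl; move: E; move: (pr_CI X) (pr_s X) => A B EB EA.
rewrite !mxE EB EA; case: (eqVneq i j) => [->|ij]; first by rewrite addbb; ring.
by case: ifP => _; ring.
Qed.

Lemma sigma_ww X (i j : 'I_n) : in_sl X -> sigma x y z X (w i) (w j) =
  (x^-1)%:C * X (w i) (w j) +
  (((x^-1)%:C - (y^-1)%:C) * X ord_max ord_max / n%:R) *+ (i == j).
Proof.
move=> Xsl; rewrite sigmaE // !widen_neq_max /= pr_CIE // widen_eq widen_neq_max.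
by case: eqP => _; rewrite ?mulr1n ?mulr0n; ring.
Qed.

Lemma sigma_wm X (i : 'I_n) : in_sl X ->
  sigma x y z X (w i) ord_max = (z^-1)%:C * X (w i) ord_max.
Proof. by move=> Xsl; rewrite sigmaE // widen_neq_max eqxx. Qed.

Lemma sigma_mw X (j : 'I_n) : in_sl X ->
  sigma x y z X ord_max (w j) = (z^-1)%:C * X ord_max (w j).
Proof. by move=> Xsl; rewrite sigmaE // widen_neq_max eqxx. Qed.

Lemma sigma_mm X : in_sl X ->
  sigma x y z X ord_max ord_max = (y^-1)%:C * X ord_max ord_max.
Proof. by move=> Xsl; rewrite sigmaE // eqxx /= pr_CIE // !eqxx; ring. Qed.

Lemma in_sl_sigma X : in_sl X -> in_sl (sigma x y z X).
Proof.
move=> Xsl; rewrite /in_sl tr_blocks sigma_mm //.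
under eq_bigr do rewrite sigma_ww // eqxx mulr1n.
rewrite big_split/= -mulr_sumr sum_widen_diag // sumr_const card_ord.
by rewrite -[_ *+ n]mulr_natr; move: ((x^-1)%:C) ((y^-1)%:C) => a b; field.
Qed.

(** The duality between the weights and [sigma]: composing the weighted form with [sigma] leaves the
    plain dot product on sl_{n+1}. *)
Lemma block_form_sigma X Y : x != 0 -> y != 0 -> z != 0 -> in_sl X -> in_sl Y ->
  block_form (weight n x%:C y%:C z%:C) (sigma x y z X) Y = \sum_i \sum_j X i j * Y i j.
Proof.
move=> x0 y0 z0 Xsl Ysl.
have := @sum_blocks R n (fun _ _ => 1) (fun i j => X i j * Y i j).
under eq_bigr do under eq_bigr do rewrite mul1r.
move=> ->.
rewrite /block_form sum_blocks sigma_mm //.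
under [X in _ * X + _ + _ + _]eq_bigr do
  under eq_bigr do rewrite sigma_ww // mulrDl mulrnAl -mulrA.
under [X in _ + _ * X + _ + _]eq_bigr do rewrite sigma_wm // -mulrA.
under [X in _ + _ + _ * X + _]eq_bigr do rewrite sigma_mw // -mulrA.
rewrite -!mulr_sumr.
under [X in _ * X + _ + _ + _]eq_bigr => i _.
  rewrite big_split/= -mulr_sumr sum_eq_l; over.
rewrite big_split/= -!mulr_sumr sum_widen_diag //.
rewrite !rmorphV ?unitfE //= /weight.
rewrite -[N%:R]natr1.
have cx : x%:C != 0 by rewrite fmorph_eq0.
have cy : y%:C != 0 by rewrite fmorph_eq0.
have cz : z%:C != 0 by rewrite fmorph_eq0.
by field; rewrite cx cy cz nn0.
Qed.

End Sigma.

Lemma sigmaK (R : realType) (n : nat) (x y z : R) (X : mat R n) : (0 < n)%N ->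
  x != 0 -> y != 0 -> z != 0 -> in_sl X ->
  sigma x y z (sigma x^-1 y^-1 z^-1 X) = X.
Proof.
move=> n0 x0 y0 z0 Xsl; have Ssl := in_sl_sigma n0 x^-1 y^-1 z^-1 Xsl.
have nn0 : n%:R != 0 :> R[i] by rewrite pnatr_eq0 -lt0n.
have cx : x%:C != 0 by rewrite fmorph_eq0.
have cy : y%:C != 0 by rewrite fmorph_eq0.
have cz : z%:C != 0 by rewrite fmorph_eq0.
apply: eq_blocks => [i j|i|j|].
- rewrite sigma_ww // sigma_ww // sigma_mm // !invrK !rmorphV ?unitfE //=.
  by case: eqP => _; rewrite ?mulr1n ?mulr0n; field; rewrite ?cx ?cy ?nn0.
- by rewrite sigma_wm // sigma_wm // invrK rmorphV ?unitfE //=; field.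
- by rewrite sigma_mw // sigma_mw // invrK rmorphV ?unitfE //=; field.
- by rewrite sigma_mm // sigma_mm // invrK rmorphV ?unitfE //=; field.
Qed.

(** * Uniqueness for complex linear systems, and linear functionals of matrix curves *)

Section ComplexLinearODE.
Context {R : realType}.
Local Notation C := R[i].

Lemma Re_sumc (I : Type) (r : seq I) (P : pred I) (F : I -> C) :
  complex.Re (\sum_(i <- r | P i) F i) = \sum_(i <- r | P i) complex.Re (F i).
Proof. by elim/big_rec2 : _ => // i x y _ <-; rewrite Re_addc. Qed.
Lemma Im_sumc (I : Type) (r : seq I) (P : pred I) (F : I -> C) :
  complex.Im (\sum_(i <- r | P i) F i) = \sum_(i <- r | P i) complex.Im (F i).
Proof. by elim/big_rec2 : _ => // i x y _ <-; rewrite Im_addc. Qed.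

Lemma linear_odeC_eq0 (K : finType) (T : R) (d : K -> R -> C)
    (A : K -> K -> R -> C) :
  (forall k, continuousC T (d k)) -> (forall k l, continuousC T (A k l)) ->
  (forall t, 0 < t < T -> forall k,
     is_deriveC t (d k) (\sum_l A k l t * d l t)) ->
  (forall k, d k 0 = 0) ->
  forall t, 0 <= t < T -> forall k, d k t = 0.
Proof.
move=> cd cA dd d0 t tT k.
(* Realification: [true] marks imaginary parts and [false] real parts, and [A'] replaces each
   complex coefficient by the real 2 by 2 matrix of multiplication by it. *)
pose d' (kb : K * bool) s :=
  if kb.2 then complex.Im (d kb.1 s) else complex.Re (d kb.1 s).
pose A' (kb lb : K * bool) s :=
  if kb.2 then (if lb.2 then complex.Re (A kb.1 lb.1 s) else complex.Im (A kb.1 lb.1 s))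
  else (if lb.2 then - complex.Im (A kb.1 lb.1 s) else complex.Re (A kb.1 lb.1 s)).
have d'0 : forall kb, d' kb t = 0.
  apply: (@linear_ode_eq0 R _ T d' A') => //.
  - by move=> [l []]; case: (cd l).
  - move=> [i []] [j []]; case: (cA i j) => // _ cI x.
    exact: (cvgN (cI x)).
  - move=> s sT [i b]; have [dr di] := dd s sT i.
    have -> : \sum_l A' (i, b) l s * d' l s =
        \sum_l (A' (i, b) (l, true) s * d' (l, true) s +
                A' (i, b) (l, false) s * d' (l, false) s).
      rewrite (eq_bigr (fun l => \sum_e A' (i, b) (l, e) s * d' (l, e) s)).
        by rewrite pair_bigA/=; apply: eq_bigr => -[].
      by move=> l _; rewrite big_bool.
    case: b => /=.
      apply: (is_derive_eq di); rewrite Im_sumc; apply: eq_bigr => l _.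
      by rewrite Im_mulc /A' /d' /=.
    apply: (is_derive_eq dr); rewrite Re_sumc; apply: eq_bigr => l _.
    by rewrite Re_mulc /A' /d' /= mulNr addrC.
  - by move=> [i []]; rewrite /d'/= d0.
have := d'0 (k, false); have := d'0 (k, true); rewrite /d'/=.
by case: (d k t) => a b /= -> ->.
Qed.

Variable m : nat.

Lemma scalar_sum_delta (L : 'M[C]_m -> C) : scalar L ->
  forall A, L A = \sum_p \sum_q A p q * L (delta_mx p q).
Proof.
move=> lL A.
pose LL := GRing.isLinear.Build _ _ _ _ L lL.
pose L' : {scalar 'M[C]_m} := HB.pack L LL.
rewrite {1}(matrix_sum_delta A) -[LHS]/(L' _) linear_sum.
apply: eq_bigr => i _; rewrite linear_sum; apply: eq_bigr => j _.
by rewrite linearZ.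
Qed.

Lemma is_deriveC_scalar t (M : R -> 'M[C]_m) (dM : 'M[C]_m) (L : 'M[C]_m -> C) :
  scalar L ->
  (forall p q, is_deriveC t (fun s => M s p q) (dM p q)) ->
  is_deriveC t (fun s => L (M s)) (L dM).
Proof.
move=> lL dMP; rewrite (scalar_sum_delta lL).
rewrite (funext (fun s => scalar_sum_delta lL (M s))).
apply: is_deriveC_sum => p; apply: is_deriveC_sum => q.
have := is_deriveCM (dMP p q) (is_deriveC_cst t (L (delta_mx p q))).
by rewrite mulr0 addr0.
Qed.

Lemma continuousC_scalar T (M : R -> 'M[C]_m) (L : 'M[C]_m -> C) : scalar L ->
  (forall p q, continuousC T (fun s => M s p q)) ->
  continuousC T (fun s => L (M s)).
Proof.
move=> lL cM.
rewrite (funext (fun s => scalar_sum_delta lL (M s))).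
apply: continuousC_sum => p; apply: continuousC_sum => q.
by apply: continuousCM => //; exact: continuousC_cst.
Qed.

End ComplexLinearODE.

(** * Projection onto the family of ansatz forms, and vanishing of the defect along the flow *)

Section Defect.
Variables (R : realType) (n : nat).
Local Notation C := R[i].
Local Notation N := n.+1.
Local Notation m := (n.+1 * n.+1)%N.
Implicit Types (u v : 'rV[C]_m) (U V K M : 'M[C]_m) (X Y Z : mat R n).
Hypothesis n_ge2 : (2 <= n)%N.

Let n_gt0 : (0 < n)%N. Proof. exact: ltn_trans n_ge2. Qed.

(** Since [2 <= n], both indices of this matrix unit lie in the upper-left block; it is
    off-diagonal, hence traceless, and reads off the weight [x]. *)
Definition unit_sln : mat R n := delta_mx ord0 (inord 1).
Definition unit_s : mat R n := delta_mx ord0 ord_max.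

Lemma in_sl_delta (i j : 'I_N) : i != j -> in_sl (delta_mx i j : mat R n).
Proof.
move=> ij; rewrite /in_sl /mxtrace big1 // => k _; rewrite mxE.
by case: (eqVneq k i) => [->|//]; rewrite (negPf ij).
Qed.

Let inord1 : (inord 1 : 'I_N) = 1%N :> nat.
Proof. by rewrite inordK // ltnS. Qed.

Lemma in_sl_unit_sln : in_sl unit_sln.
Proof. by apply: in_sl_delta; rewrite -val_eqE/= inord1. Qed.

Lemma in_sl_unit_s : in_sl unit_s.
Proof. by apply: in_sl_delta; rewrite -val_eqE/= neq_ltn n_gt0. Qed.

Lemma block_form_delta (c : bool -> bool -> C) (i j : 'I_N) :
  block_form c (delta_mx i j : mat R n) (delta_mx i j : mat R n) =
  c (i == ord_max) (j == ord_max).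
Proof.
rewrite /block_form.
transitivity (\sum_(k < N) \sum_(l < N)
   (\matrix_(k, l) c (k == ord_max) (l == ord_max) : mat R n) k l *
   (delta_mx i j : mat R n) k l).
  apply: eq_bigr => k _; apply: eq_bigr => l _; rewrite !mxE.
  by case: (_ && _); rewrite ?mulr1 ?mulr0.
by rewrite dot_delta mxE.
Qed.

Lemma block_form_unit_sln x y z :
  block_form (weight n x y z) unit_sln unit_sln = x :> C.
Proof.
rewrite block_form_delta -!val_eqE/= inord1 [_ == n]ltn_eqF //.
by rewrite ltn_eqF.
Qed.

Lemma block_form_unit_s x y z :
  block_form (weight n x y z) unit_s unit_s = z :> C.
Proof. by rewrite block_form_delta eqxx -val_eqE/= ltn_eqF. Qed.

(** Three test matrices, one in each summand of sl_{n+1}, recover the three weights, so this is a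
    linear projection onto the family of forms dual to the [sigma] metrics. *)
Definition ansatz K : 'M[C]_m := block_mat n (weight n (bil unit_sln unit_sln K)
  (bil (Imat R n) (Imat R n) K) (bil unit_s unit_s K)).

Lemma ansatz_is_linear : linear ansatz.
Proof.
move=> k K K'; rewrite /ansatz /block_mat scaler_sumr -big_split/=.
apply: eq_bigr => i _; rewrite scaler_sumr -big_split/=; apply: eq_bigr => j _.
rewrite scalerA -scalerDl; congr (_ *: _).
rewrite !bil_is_scalar /weight.
by case: (i == _); case: (j == _) => //=; ring.
Qed.

(** Compression by [traceless] keeps only the values on sl_{n+1}, where [quad] is known to preserve
    the family. *)
Definition defect K : 'M[C]_m := traceless R n *m (K - ansatz K) *m traceless R n.

Lemma defect_is_linear : linear defect.
Proof.
move=> k K K'; rewrite /defect ansatz_is_linear.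
move: (traceless R n) => P; rewrite scalemxAl -mulmxDl scalemxAr -mulmxDr.
by rewrite scalerBr opprD addrACA.
Qed.

HB.instance Definition _ :=
  GRing.isLinear.Build C 'M[C]_m 'M[C]_m _ defect defect_is_linear.

Lemma bil_traceless X Y K : in_sl X -> in_sl Y ->
  bil X Y (traceless R n *m K *m traceless R n) = bil X Y K.
Proof.
move=> Xsl Ysl; rewrite /bil -!mulmxA -[traceless R n *m (vec Y)^T]trmxK.
rewrite trmx_mul trmxK traceless_tr traceless_id ?vecK // !mulmxA.
by rewrite traceless_id ?vecK.
Qed.

Lemma bil_defect X Y K : in_sl X -> in_sl Y ->
  bil X Y (defect K) = bil X Y K - block_form (weight n (bil unit_sln unit_sln K)
  (bil (Imat R n) (Imat R n) K) (bil unit_s unit_s K)) X Y.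
Proof. by move=> Xsl Ysl; rewrite /defect bil_traceless // linearB/= bil_block_mat. Qed.

Lemma defect_eq0 K (x y z : C) :
  (forall X Y, in_sl X -> in_sl Y -> bil X Y K = block_form (weight n x y z) X Y) ->
  defect K = 0.
Proof.
move=> KP; apply/matrixP => p q; rewrite [RHS]mxE.
pose sp := unvec (delta_mx 0 p *m traceless R n).
pose sq := unvec (delta_mx 0 q *m traceless R n).
have spP : in_sl sp by exact: tr_unvec_traceless.
have sqP : in_sl sq by exact: tr_unvec_traceless.
(* An entry of the defect is a value on the traceless parts of two matrix units, to which the
   hypothesis applies. *)
have -> : defect K p q = bil sp sq (K - ansatz K).
  have E (A : 'M[C]_m) : A p q =
      ((delta_mx 0 p : 'rV_m) *m A *m (delta_mx 0 q : 'rV_m)^T) 0 0.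
    by rewrite trmx_delta -colE -rowE !mxE.
  by rewrite [LHS]E /bil !unvecK trmx_mul traceless_tr /defect !mulmxA.
rewrite linearB/= bil_block_mat !KP //.
- by rewrite block_form_unit_sln block_form_Imat // block_form_unit_s subrr.
- exact: in_sl_unit_s.
- exact: in_sl_unit_s.
- exact: in_sl_Imat.
- exact: in_sl_Imat.
- exact: in_sl_unit_sln.
- exact: in_sl_unit_sln.
Qed.

Lemma defect_quad_ansatz K : defect (quad (ansatz K) (ansatz K)) = 0.
Proof. by apply: defect_eq0 => X Y Xsl Ysl; rewrite /ansatz quad_weight. Qed.

(** With A the ansatz and D the defect of M, quad(M, M) - quad(A, A) = quad(D, M) + quad(A, D), as
    [quad] does not see the compression in D. The defect of quad(A, A) is zero because the family is
    preserved. *)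
Lemma defect_quad M : defect (quad M M) =
  defect (quad (defect M) M + quad (ansatz M) (defect M)).
Proof.
have E1 : quad (defect M) M = quad M M - quad (ansatz M) M.
  by rewrite /defect quad_tracelessl quadBl.
have E2 : quad (ansatz M) (defect M) = quad (ansatz M) M - quad (ansatz M) (ansatz M).
  by rewrite /defect quad_tracelessr quadBr.
have defectB A B : defect (A - B) = defect A - defect B by exact: linearB.
by rewrite E1 E2 addrA subrK defectB defect_quad_ansatz subr0.
Qed.

Lemma defect_ode_eq0 (T : R) (M : R -> 'M[C]_m) :
  (forall p q, continuousC T (fun s => M s p q)) ->
  (forall t, 0 < t < T -> forall p q,
     is_deriveC t (fun s => M s p q) (quad (M t) (M t) p q)) ->
  defect (M 0) = 0 -> forall t, 0 <= t < T -> defect (M t) = 0.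
Proof.
move=> cM dM M0 t tT; apply/matrixP => p q; rewrite [RHS]mxE.
(* The equation for the defect has right-hand side [G (M s) (defect (M s))]: linear in the defect by
   [Gr], with coefficients linear in [M s] by [Gl] and therefore continuous. *)
pose G U V := defect (quad V U + quad (ansatz U) V).
have Gl (V : 'M[C]_m) : linear (G ^~ V).
  move=> k U U'; rewrite /G -defect_is_linear ansatz_is_linear.
  by rewrite quad_is_linear_r quad_is_linear_l scalerDr addrACA.
have Gr (U : 'M[C]_m) : linear (G U).
  move=> k V V'; rewrite /G -defect_is_linear.
  by rewrite quad_is_linear_r quad_is_linear_l scalerDr addrACA.
have entry (L : 'M[C]_m -> 'M[C]_m) i j : linear L -> scalar (fun K => L K i j).
  by move=> lL k K K'; rewrite lL !mxE.
apply: (@linear_odeC_eq0 R ('I_m * 'I_m)%type T (fun k s => defect (M s) k.1 k.2)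
  (fun k l s => G (M s) (delta_mx l.1 l.2) k.1 k.2) _ _ _ _ t tT (p, q)).
- move=> k; apply: (continuousC_scalar (entry defect k.1 k.2 defect_is_linear)).
  exact: cM.
- move=> k l.
  exact: (continuousC_scalar (entry (G ^~ (delta_mx l.1 l.2)) k.1 k.2 (Gl _))).
- move=> s sT k.
  have D := is_deriveC_scalar (entry defect k.1 k.2 defect_is_linear) (dM s sT).
  have E := scalar_sum_delta (entry (G (M s)) k.1 k.2 (Gr _)) (defect (M s)).
  suff -> : \sum_l G (M s) (delta_mx l.1 l.2) k.1 k.2 * defect (M s) l.1 l.2 =
      defect (quad (M s) (M s)) k.1 k.2 by [].
  rewrite defect_quad [RHS]E pair_bigA; apply: eq_bigr => l _.
  exact: mulrC.
- by move=> k; rewrite M0 mxE.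
Qed.

End Defect.

(** * Gram matrices of metrics and their inverses *)

Section Gram.
Variables (R : realType) (n : nat).
Local Notation C := R[i].
Local Notation N := n.+1.
Local Notation m := (n.+1 * n.+1)%N.
Implicit Types (u v : 'rV[C]_m) (X Y Z : mat R n).

Definition conjv k l (A : 'M[C]_(k, l)) : 'M[C]_(k, l) := map_mx (@conjc R) A.

Lemma conjvK k l : involutive (@conjv k l).
Proof. by move=> A; apply/matrixP => i j; rewrite !mxE conjcK. Qed.

Lemma conjvM k l r (A : 'M[C]_(k, l)) (B : 'M[C]_(l, r)) :
  conjv (A *m B) = conjv A *m conjv B.
Proof. exact: map_mxM. Qed.

Lemma conj_bracket u v : bracket (conjv u) (conjv v) = conjv (bracket u v).
Proof.
rewrite /bracket /vec /unvec /conjv -!map_vec_mx map_mxvec; congr mxvec.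
by rewrite /lie !map_mxB !map_mxM.
Qed.

Lemma conj_vec (X : mat R n) : conjv (vec X) = vec (conjv X : mat R n).
Proof. exact: map_mxvec. Qed.

Lemma tr_conjv (X : mat R n) : \tr (conjv X) = conjc (\tr X).
Proof. exact: trace_map_mx. Qed.

Lemma conj_one_vec : conjv (one_vec R n) = one_vec R n.
Proof. by rewrite /one_vec /vec /conjv map_mxvec map_mx1. Qed.

(* [h] extended to gl_{n+1}(C) by making the identity matrix a vector of squared
   norm [n + 1] orthogonal to sl_{n+1}(C). *)
Definition gram (h : mat R n -> mat R n -> C) : 'M[C]_m :=
  \matrix_(p, q) (h (unvec (delta_mx 0 p *m traceless R n))
                    (unvec (delta_mx 0 q *m traceless R n)) +
     N%:R^-1 * (\tr (unvec (delta_mx 0 p : 'rV[C]_m)) *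
                \tr (unvec (delta_mx 0 q : 'rV[C]_m)))).

(** The inverse is written by Cramer's rule, so that regularity in time passes from the entries of
    [gram] to those of the dual. *)
Definition dual_gram h : 'M[C]_m := (\det (gram h))^-1 *: \adj (gram h).

Variable h : mat R n -> mat R n -> C.
Hypothesis hip : herm_ip h.

Lemma in_sl_sum (I : Type) (r : seq I) (a : I -> C) (F : I -> mat R n) :
  (forall i, in_sl (F i)) -> in_sl (\sum_(i <- r) a i *: F i).
Proof.
move=> Fsl; rewrite /in_sl linear_sum big1 // => i _.
by rewrite linearZ/= Fsl mulr0.
Qed.

Lemma herm_suml (I : Type) (r : seq I) (a : I -> C) (F : I -> mat R n) Z :
  (forall i, in_sl (F i)) -> in_sl Z ->
  h (\sum_(i <- r) a i *: F i) Z = \sum_(i <- r) a i * h (F i) Z.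
Proof.
case: hip => lin _ _ Fsl Zsl.
have sl0 : in_sl (0 : mat R n) by exact: linear0.
elim: r => [|i r IH]; last by rewrite !big_cons lin // ?IH //; exact: in_sl_sum.
rewrite !big_nil; have := lin 1 0 0 Z sl0 sl0 Zsl.
by rewrite scaler0 addr0 mul1r => /esym/eqP; rewrite -subr_eq0 addrK => /eqP.
Qed.

Lemma herm_sumr (I : Type) (r : seq I) (a : I -> C) (F : I -> mat R n) Z :
  (forall i, in_sl (F i)) -> in_sl Z ->
  h Z (\sum_(i <- r) a i *: F i) = \sum_(i <- r) conjc (a i) * h Z (F i).
Proof.
move=> Fsl Zsl; case: (hip) => _ sym _.
rewrite sym // ?herm_suml //; last exact: in_sl_sum.
rewrite rmorph_sum; apply: eq_bigr => i _.
by rewrite rmorphM; congr (_ * _); exact/esym/sym.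
Qed.

Lemma unvec_sum u : unvec (u *m traceless R n) =
  \sum_p u 0 p *: unvec (delta_mx 0 p *m traceless R n).
Proof.
rewrite {1}(row_sum_delta u) mulmx_suml /unvec linear_sum; apply: eq_bigr => p _.
by rewrite -scalemxAl linearZ.
Qed.

Lemma tr_sum u : \tr (unvec u) = \sum_p u 0 p * \tr (unvec (delta_mx 0 p)).
Proof.
rewrite {1}(row_sum_delta u) /unvec !linear_sum; apply: eq_bigr => p _.
by rewrite !linearZ.
Qed.

Lemma tr_delta_conj (p : 'I_m) :
  conjc (\tr (unvec (delta_mx 0 p : 'rV[C]_m))) = \tr (unvec (delta_mx 0 p : 'rV[C]_m)).
Proof.
have -> : \tr (unvec (delta_mx 0 p : 'rV[C]_m)) = one_vec R n 0 p.
  by rewrite -dot1 unvecK -rowE !mxE.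
by have /matrixP/(_ 0 p) := conj_one_vec; rewrite mxE.
Qed.

Lemma gramE u v : (u *m gram h *m (conjv v)^T) 0 0 =
  h (unvec (u *m traceless R n)) (unvec (v *m traceless R n)) +
  N%:R^-1 * (\tr (unvec u) * conjc (\tr (unvec v))).
Proof.
have slt w : in_sl (unvec (w *m traceless R n)) by exact: tr_unvec_traceless.
rewrite (unvec_sum u) herm_suml // tr_sum mulr_suml mulr_sumr -big_split/=.
rewrite -mulmxA mxE; apply: eq_bigr => p _.
rewrite mxE (unvec_sum v) herm_sumr // (tr_sum v) rmorph_sum !mulr_sumr -big_split/=.
apply: eq_bigr => q _; rewrite [(gram h) p q]mxE [(conjv v)^T q 0]mxE.
rewrite [conjv v 0 q]mxE rmorphM /= tr_delta_conj; move: (conjc _) => a.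
rewrite -mulr_sumr -[\sum_i unvec _ i i]/(\tr _); ring.
Qed.

Lemma gram_sl X Y : in_sl X -> in_sl Y ->
  (vec X *m gram h *m (conjv (vec Y))^T) 0 0 = h X Y.
Proof.
by move=> Xsl Ysl; rewrite gramE !vecK Xsl mul0r mulr0 addr0 !traceless_id ?vecK.
Qed.

Lemma one_vec_traceless : one_vec R n *m traceless R n = 0.
Proof.
rewrite mul_traceless /one_vec vecK mxtrace1 mulVf ?pnatr_eq0 //.
by rewrite scale1r subrr.
Qed.

Lemma row_eq_dot u v : (forall x : 'rV[C]_m, (u *m x^T) 0 0 = (v *m x^T) 0 0) -> u = v.
Proof.
move=> E; apply/rowP => j; have := E (delta_mx 0 j).
by rewrite trmx_delta -!colE !mxE.
Qed.

Lemma col_eq_dot (u v : 'cV[C]_m) :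
  (forall x : 'rV[C]_m, (x *m u) 0 0 = (x *m v) 0 0) -> u = v.
Proof.
by move=> E; apply/colP => j; have := E (delta_mx 0 j); rewrite -!rowE !mxE.
Qed.

Lemma herm0l Z : in_sl Z -> h 0 Z = 0.
Proof.
move=> Zsl; have := @herm_suml void [::] (fun=> 0) (fun=> 0) Z _ Zsl.
by rewrite !big_nil; apply.
Qed.

Lemma herm0r Z : in_sl Z -> h Z 0 = 0.
Proof.
move=> Zsl; have := @herm_sumr void [::] (fun=> 0) (fun=> 0) Z _ Zsl.
by rewrite !big_nil; apply.
Qed.

Lemma gram_one : gram h *m (one_vec R n)^T = (one_vec R n)^T.
Proof.
apply: col_eq_dot => x; rewrite mulmxA -conj_one_vec gramE one_vec_traceless.
rewrite /unvec linear0 herm0r ?add0r; last exact: tr_unvec_traceless.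
have -> : \tr (vec_mx (one_vec R n)) = N%:R by rewrite -/(unvec _) vecK mxtrace1.
by rewrite conj_one_vec -dot1 unvecK rmorph_nat mulrCA mulVf ?pnatr_eq0 // mulr1.
Qed.

(** If the traceless part is nonzero, [h] is positive on it and the trace term is nonnegative.
    Otherwise [u] is a nonzero multiple of the identity and the trace term is positive. *)
Lemma gram_gt0 u : u != 0 -> 0 < (u *m gram h *m (conjv u)^T) 0 0.
Proof.
move=> u0; rewrite gramE; case: hip => _ _ pos.
set X := unvec (u *m _).
have Xsl : in_sl X by exact: tr_unvec_traceless.
have t0 : 0 <= N%:R^-1 * (\tr (unvec u) * conjc (\tr (unvec u))).
  by rewrite mulr_ge0 ?invr_ge0 ?ler0n // mulcJ_ge0.
have [X0|X0] := eqVneq X 0; last by rewrite ltr_pwDl // pos.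
have sl0 : in_sl (0 : mat R n) by exact: linear0.
rewrite X0 herm0l // add0r lt_def t0 andbT.
apply: contra u0; rewrite mulf_eq0 invr_eq0 pnatr_eq0/= mulf_eq0 conjc_eq0 orbb.
move=> /eqP tu; apply/eqP.
by rewrite -(traceless_id tu) -[LHS]unvecK -/X X0 /vec linear0.
Qed.

Lemma gram_unit : gram h \in unitmx.
Proof.
rewrite -row_free_unit; apply: inj_row_free => u ug0.
by apply/eqP; apply/negPn/negP => /gram_gt0; rewrite ug0 mul0mx mxE ltxx.
Qed.

Lemma det_gram_neq0 : \det (gram h) != 0.
Proof. by rewrite -unitfE; exact: gram_unit. Qed.

Lemma dual_gramE : dual_gram h = invmx (gram h).
Proof. by rewrite /dual_gram /invmx gram_unit. Qed.

Lemma mul_gram_dual : gram h *m dual_gram h = 1%:M.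
Proof. by rewrite dual_gramE mulmxV // gram_unit. Qed.

Lemma mul_dual_gram : dual_gram h *m gram h = 1%:M.
Proof. by rewrite dual_gramE mulVmx // gram_unit. Qed.

Lemma dual_gram_one : dual_gram h *m (one_vec R n)^T = (one_vec R n)^T.
Proof. by rewrite -{1}gram_one mulmxA mul_dual_gram mul1mx. Qed.

(** The inverse of a positive Hermitian form is positive: the value is the conjugate of the Gram
    form at [u]. As [bil] takes no conjugate, [X] is required to be real. *)
Lemma bil_dual_gram_gt0 X : X != 0 -> conjv X = X -> 0 < bil X X (dual_gram h).
Proof.
move=> X0 Xr.
have Xv : conjv (vec X) = vec X by rewrite /conjv /vec map_mxvec -/(conjv X) Xr.
pose u := conjv (dual_gram h *m (vec X)^T)^T.
have uE : (conjv u)^T = dual_gram h *m (vec X)^T by rewrite conjvK trmxK.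
have u0 : u != 0.
  apply: contra X0 => /eqP u0; move: uE; rewrite u0 /conjv map_mx0 trmx0.
  move=> /(congr1 (mulmx (gram h))); rewrite mulmx0 mulmxA mul_gram_dual mul1mx.
  move=> /(congr1 trmx); rewrite trmxK trmx0 => /(congr1 (@unvec R n)).
  by rewrite vecK /unvec linear0 => <-.
have := gram_gt0 u0; rewrite -mulmxA uE [gram h *m _]mulmxA mul_gram_dual mul1mx.
have -> : (u *m (vec X)^T) 0 0 = conjc (bil X X (dual_gram h)).
  have -> : u *m (vec X)^T = (vec X *m u^T)^T by rewrite trmx_mul trmxK.
  have -> : u^T = conjv (dual_gram h *m (vec X)^T) by apply/matrixP => i j; rewrite !mxE.
  by rewrite -{1}Xv -conjvM mulmxA /bil [LHS]mxE [LHS]mxE.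
by rewrite !ltcE /=; case: (bil X X _) => a b /=; rewrite oppr_eq0.
Qed.

End Gram.

(** * Unitary bases and the matrix of [Theta] *)

Lemma sum_ltn_sym (F : fieldType) (V : lmodType F) (k : nat) (f : 'I_k -> 'I_k -> V) :
  2 != 0 :> F -> (forall i j, f i j = f j i) -> (forall i, f i i = 0) ->
  \sum_(i < k) \sum_(j < k | (i < j)%N) f i j =
  2^-1 *: (\sum_(i < k) \sum_(j < k) f i j).
Proof.
move=> two0 fC f0.
have -> : \sum_(i < k) \sum_(j < k) f i j =
    \sum_(i < k) \sum_(j < k | (i < j)%N) f i j +
    \sum_(i < k) \sum_(j < k | (j < i)%N) f i j.
  rewrite -big_split/=; apply: eq_bigr => i _.
  rewrite (bigID (fun j : 'I_k => (i < j)%N))/=; congr (_ + _).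
  rewrite (bigID (fun j : 'I_k => j == i))/= big1 ?add0r.
    by apply: eq_bigl => j; rewrite -leqNgt ltn_neqAle andbC.
  by move=> j /andP[_ /eqP ->].
have <- : \sum_(i < k) \sum_(j < k | (i < j)%N) f i j =
    \sum_(i < k) \sum_(j < k | (j < i)%N) f i j.
  rewrite (exchange_big_dep predT)//=; apply: eq_bigr => i _.
  by apply: eq_bigr => j _; rewrite fC.
by rewrite -mulr2n -scaler_nat scalerA mulVf // scale1r.
Qed.

(** Stated for two dimensions that are equal but not convertible, such as [dim_sl n + 1] and the
    square of [n.+1]. *)
Lemma mulmx1C_rect (F : fieldType) (k l : nat) (A : 'M[F]_(k, l)) (B : 'M[F]_(l, k)) :
  k = l -> A *m B = 1%:M -> B *m A = 1%:M.
Proof. by move=> kl; case: l / kl A B => A B; exact: mulmx1C. Qed.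

Lemma mulmx_rows (F : fieldType) (k l r s : nat) (A : 'M[F]_(k, l))
    (B : 'M[F]_(l, r)) (D : 'M[F]_(s, r)) i j :
  (A *m B *m D^T) i j = (row i A *m B *m (row j D)^T) 0 0.
Proof.
by rewrite -row_mul !mxE; apply: eq_bigr => q _; rewrite !mxE.
Qed.

Section UnitaryBasis.
Variables (R : realType) (n : nat).
Local Notation C := R[i].
Local Notation N := n.+1.
Local Notation m := (n.+1 * n.+1)%N.
Variable h : mat R n -> mat R n -> C.
Hypothesis hip : herm_ip h.
Variable e : 'I_(dim_sl n) -> mat R n.
Hypothesis eP : unitary_basis h e.

Let e_sl i : in_sl (e i). Proof. by case: eP. Qed.

Let W : 'M[C]_m := \sum_i (conjv (vec (e i)))^T *m vec (e i).

(** The [e i] together with the identity form an orthogonal basis of gl_{n+1}; an inverse Gram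
    matrix is the sum of conj(v)^T v over such a basis, each divided by the squared norm of v, which
    is [N] for the identity. *)
Lemma dual_gram_unitary :
  dual_gram h = W + N%:R^-1 *: ((one_vec R n)^T *m one_vec R n).
Proof.
have N0 : N%:R != 0 :> C by rewrite pnatr_eq0.
pose A : 'M[C]_(dim_sl n, m) := \matrix_i vec (e i).
have AW : W = (conjv A)^T *m A.
  apply/matrixP => p q; rewrite summxE [RHS]mxE; apply: eq_bigr => i _.
  by rewrite mxE big_ord1 !mxE.
suff GW : gram h *m (W + N%:R^-1 *: ((one_vec R n)^T *m one_vec R n)) = 1%:M.
  by rewrite -[RHS]mul1mx -(mul_dual_gram hip) -mulmxA GW mulmx1.
pose o := one_vec R n.
have -> : gram h *m (W + N%:R^-1 *: (o^T *m o)) =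
  row_mx (gram h *m (conjv A)^T) (N%:R^-1 *: (gram h *m o^T)) *m col_mx A o.
  by rewrite mul_row_col AW mulmxDr !mulmxA -scalemxAr -scalemxAl mulmxA.
(* One-sided inverses of square matrices are two-sided, so the reversed product is checked instead;
   its four blocks are the orthogonality relations of the extended basis. *)
apply: mulmx1C_rect; first by rewrite addn1 /dim_sl prednK.
rewrite mul_col_row (gram_one hip).
have -> : A *m (gram h *m (conjv A)^T) = 1%:M.
  apply/matrixP => i j; rewrite mulmxA.
  have -> : (A *m gram h *m (conjv A)^T) i j =
      (vec (e i) *m gram h *m (conjv (vec (e j)))^T) 0 0.
    by rewrite mulmx_rows /conjv -map_row !rowK.
  by rewrite (gram_sl hip) // mxE; case: eP => _ ->; case: eqP.
have -> : A *m (N%:R^-1 *: o^T) = 0.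
  apply/row_matrixP => i; rewrite row_mul rowK row0 -scalemxAr.
  by apply/matrixP => a b; rewrite !ord1 mxE dot1 e_sl mulr0 mxE.
have -> : o *m (gram h *m (conjv A)^T) = 0.
  apply/matrixP => i j; rewrite mulmxA mulmx_rows /conjv -map_row rowK row_id.
  rewrite -/(conjv _) gramE // one_vec_traceless /unvec linear0.
  rewrite (herm0l hip) ?add0r; last exact: tr_unvec_traceless.
  by rewrite -/(unvec (vec (e j))) (vecK (e j)) e_sl rmorph0 !mulr0 mxE.
have -> : o *m (N%:R^-1 *: o^T) = 1%:M.
  by rewrite -scalemxAr (mx11_scalar (o *m _)) dot1 mxtrace1 scale_scalar_mx mulVf.
by rewrite -scalar_mx_block.
Qed.

Lemma traceless_dual_gram :
  traceless R n *m dual_gram h *m traceless R n = W.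
Proof.
have e_tr i : vec (e i) *m traceless R n = vec (e i).
  by apply: traceless_id; rewrite vecK e_sl.
have c_tr i : conjv (vec (e i)) *m traceless R n = conjv (vec (e i)).
  by rewrite conj_vec; apply: traceless_id; rewrite vecK tr_conjv e_sl conjc0.
have E (P A : 'M[C]_m) k (u : 'rV[C]_m) : P *m (A + k *: (u^T *m u)) *m P =
    P *m A *m P + k *: (P *m u^T *m (u *m P)).
  by rewrite mulmxDr mulmxDl -scalemxAr -scalemxAl !mulmxA.
rewrite dual_gram_unitary E one_vec_traceless mulmx0 scaler0 addr0.
rewrite mulmx_sumr mulmx_suml.
apply: eq_bigr => i _; rewrite mulmxA -mulmxA e_tr; congr (_ *m _).
by rewrite -{1}traceless_tr -trmx_mul c_tr.
Qed.

(** Only the traceless part [W] matters for [quad], and on it [quad_rank1] gives half the sum over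
    all pairs. The summand is symmetric, since the bracket enters twice, and zero on the
    diagonal. *)
Lemma quad_dual_gram : quad (dual_gram h) (dual_gram h) =
  \sum_(i < dim_sl n) \sum_(j < dim_sl n | (i < j)%N)
    (conjv (vec (lie (e i) (e j))))^T *m vec (lie (e i) (e j)).
Proof.
pose f i j := (conjv (vec (lie (e i) (e j))))^T *m vec (lie (e i) (e j)).
have fC i j : f i j = f j i.
  rewrite /f; have -> : lie (e i) (e j) = - lie (e j) (e i) by rewrite /lie opprB.
  have -> : vec (- lie (e j) (e i)) = - vec (lie (e j) (e i)) by exact: linearN.
  have -> : conjv (- vec (lie (e j) (e i))) = - conjv (vec (lie (e j) (e i))).
    exact: map_mxN.
  have -> (v : 'rV[C]_m) : (- v)^T = - v^T by exact: linearN.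
  by rewrite mulNmx mulmxN opprK.
have f0 i : f i i = 0 by rewrite /f /lie subrr /vec linear0 mulmx0.
have two0 : 2 != 0 :> C by rewrite pnatr_eq0.
apply: etrans _ (esym (sum_ltn_sym two0 fC f0)).
rewrite -quad_tracelessl -quad_tracelessr traceless_dual_gram.
rewrite quad_suml scaler_sumr; apply: eq_bigr => i _.
rewrite quad_sumr scaler_sumr; apply: eq_bigr => j _.
by rewrite quad_rank1 conj_bracket /bracket !vecK.
Qed.

(** [Theta] on the same vectors as in [gram]. The trace term of [gram] being constant in time, the
    flow says that the Gram matrix has derivative [- Theta_mat]. *)
Definition Theta_mat : 'M[C]_m := \matrix_(p, q)
  Theta h e (unvec (delta_mx 0 p *m traceless R n))
            (unvec (delta_mx 0 q *m traceless R n)).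

Lemma Theta_matE :
  Theta_mat = gram h *m quad (dual_gram h) (dual_gram h) *m gram h.
Proof.
have lsl i j : in_sl (lie (e i) (e j)).
  by rewrite /in_sl /lie linearB/= mxtrace_mulC subrr.
have ltr i j : vec (lie (e i) (e j)) *m traceless R n = vec (lie (e i) (e j)).
  by apply: traceless_id; rewrite vecK lsl.
rewrite quad_dual_gram; apply/matrixP => p q; rewrite [LHS]mxE.
rewrite mulmx_sumr mulmx_suml summxE; apply: eq_bigr => i _.
rewrite mulmx_sumr mulmx_suml summxE; apply: eq_bigr => j _.
rewrite mulmxA -mulmxA mxE big_ord1; congr (_ * _).
  have -> : (gram h *m (conjv (vec (lie (e i) (e j))))^T) p 0 =
    ((delta_mx 0 p : 'rV[C]_m) *m gram h *m (conjv (vec (lie (e i) (e j))))^T) 0 0.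
    by rewrite -mulmxA -rowE [RHS]mxE.
  by rewrite gramE // ltr vecK lsl rmorph0 !mulr0 addr0.
have -> : (vec (lie (e i) (e j)) *m gram h) 0 q =
    (vec (lie (e i) (e j)) *m gram h *m (conjv (delta_mx 0 q : 'rV[C]_m))^T) 0 0.
  by rewrite /conjv map_delta_mx trmx_delta -colE [RHS]mxE.
by rewrite gramE // ltr vecK lsl mul0r mulr0 addr0.
Qed.

End UnitaryBasis.

(** * Regularity of the dual metric along the flow, and its quadratic equation *)

Section Flow.
Variables (R : realType) (n : nat) (T : R).
Local Notation C := R[i].
Local Notation N := n.+1.
Local Notation m := (n.+1 * n.+1)%N.
Variables (h0 : mat R n -> mat R n -> C) (h : R -> mat R n -> mat R n -> C).
Hypothesis hsol : PHCF_solution T h0 h.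

Let G s := gram (h s).
Let M s := dual_gram (h s).

Let hip t : 0 <= t < T -> herm_ip (h t).
Proof. by case: hsol => H _ _ _; exact: H. Qed.

Lemma continuousC_gram p q : continuousC T (fun s => G s p q).
Proof.
rewrite (_ : (fun s => _) = fun s => h s (unvec (delta_mx 0 p *m traceless R n))
    (unvec (delta_mx 0 q *m traceless R n)) + N%:R^-1 *
    (\tr (unvec (delta_mx 0 p : 'rV[C]_m)) * \tr (unvec (delta_mx 0 q : 'rV[C]_m)))).
  apply: continuousCD; last exact: continuousC_cst.
  by case: hsol => _ _ H _; apply: H; exact: tr_unvec_traceless.
by apply/funext => s; rewrite mxE.
Qed.

Lemma continuousC_dual_gram p q : continuousC T (fun s => M s p q).
Proof.
rewrite (_ : (fun s => _) = fun s => (\det (G s))^-1 * (\adj (G s)) p q); last first.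
  by apply/funext => s; rewrite mxE.
apply: continuousCM.
  apply: continuousCV.
    by move=> t tT; apply: det_gram_neq0; exact: hip.
  apply: (@det_closed R (continuousC T)) continuousC_gram.
  - exact: continuousC_cst.
  - exact: continuousCD.
  - exact: continuousCM.
apply: (@adj_closed R (continuousC T)) continuousC_gram _ _.
- exact: continuousC_cst.
- exact: continuousCD.
- exact: continuousCM.
Qed.

Lemma is_deriveC_near t (f g : R -> C) df : (\forall s \near t, f s = g s) ->
  is_deriveC t f df -> is_deriveC t g df.
Proof.
move=> fg [fr fi]; split.
  by apply: near_eq_is_derive fr; apply: filterS fg => s ->.
by apply: near_eq_is_derive fi; apply: filterS fg => s ->.
Qed.

Lemma derivableC_dual_gram t p q : 0 < t < T ->
  (forall p q, derivableC t (fun s => G s p q)) ->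
  derivableC t (fun s => M s p q).
Proof.
move=> /andP[t0 tT] dG.
have c_cst c : derivableC t (fun=> c) by exists 0; exact: is_deriveC_cst.
have c_add f g : derivableC t f -> derivableC t g -> derivableC t (fun s => f s + g s).
  by move=> [df fP] [dg gP]; eexists; exact: (is_deriveCD fP gP).
have c_mul f g : derivableC t f -> derivableC t g -> derivableC t (fun s => f s * g s).
  by move=> [df fP] [dg gP]; eexists; exact: (is_deriveCM fP gP).
rewrite (_ : (fun s => _) = fun s => (\det (G s))^-1 * (\adj (G s)) p q); last first.
  by apply/funext => s; rewrite mxE.
apply: (c_mul); last exact: (@adj_closed R (derivableC t)).
apply: derivableCV; last exact: (@det_closed R (derivableC t)).
by apply: det_gram_neq0; apply: hip; rewrite ltW.
Qed.

(* Differentiating [G * M = 1] turns the flow, which is rational in the metric,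
   into a quadratic equation for its dual. *)
Lemma is_deriveC_dual_gram t : 0 < t < T -> forall p q,
  is_deriveC t (fun s => M s p q) (quad (M t) (M t) p q).
Proof.
move=> t0T; have /andP[t0 tT] := t0T.
have ht : herm_ip (h t) by apply: hip; rewrite ltW.
have [_ _ _ /(_ t t0T)[e [eP dh]]] := hsol.
have dG p q : is_deriveC t (fun s => G s p q) (- Theta_mat (h t) e p q).
  rewrite (_ : (fun s => _) = fun s => h s (unvec (delta_mx 0 p *m traceless R n))
    (unvec (delta_mx 0 q *m traceless R n)) + N%:R^-1 *
    (\tr (unvec (delta_mx 0 p : 'rV[C]_m)) * \tr (unvec (delta_mx 0 q : 'rV[C]_m)))).
    rewrite -[X in is_deriveC _ _ X]addr0.
    apply: is_deriveCD; last exact: is_deriveC_cst.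
    by rewrite mxE; apply: dh; exact: tr_unvec_traceless.
  by apply/funext => s; rewrite mxE.
have [dM dMP] : exists dM : 'M[C]_m,
    forall p q, is_deriveC t (fun s => M s p q) (dM p q).
  have H p q : exists d, is_deriveC t (fun s => M s p q) d.
    by apply: derivableC_dual_gram => // i j; eexists; exact: dG.
  have [F FP] := choice (fun pq : 'I_m * 'I_m => H pq.1 pq.2).
  by exists (\matrix_(p, q) F (p, q)) => p q; rewrite mxE; exact: (FP (p, q)).
have E : - Theta_mat (h t) e *m M t + G t *m dM = 0.
  apply/matrixP => p q.
  have D1 : is_deriveC t (fun s => \sum_r G s p r * M s r q)
      (\sum_r (- Theta_mat (h t) e p r * M t r q + G t p r * dM r q)).
    by apply: is_deriveC_sum => r; exact: (is_deriveCM (dG p r) (dMP r q)).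
  (* The product is known to be the identity only for times in [0, T), which contains a
     neighbourhood of the interior time [t]. *)
  have D2 : is_deriveC t (fun s => \sum_r G s p r * M s r q) 0.
    apply: is_deriveC_near (is_deriveC_cst t ((1%:M : 'M[C]_m) p q)).
    have ti : t \in `]0, T[%R by rewrite in_itv.
    apply: filterS (near_in_itvoo ti) => s; rewrite in_itv/= => /andP[s0 sT].
    rewrite -(@mul_gram_dual _ _ (h s)) ?mxE //.
    by apply: hip; rewrite ltW.
  rewrite [RHS]mxE -(is_deriveC_uniq D1 D2) mxE big_split/=; congr (_ + _).
    by rewrite mxE; apply: eq_bigr => r _; rewrite mxE.
  by rewrite mxE.
have -> : quad (M t) (M t) = dM; last exact: dMP.
move/eqP: E; rewrite mulNmx addrC subr_eq0 => /eqP /(congr1 (mulmx (M t))).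
rewrite mulmxA /M /G (mul_dual_gram ht) mul1mx => ->.
rewrite (Theta_matE ht eP) !mulmxA (mul_dual_gram ht) mul1mx -mulmxA.
by rewrite (mul_gram_dual ht) mulmx1.
Qed.

End Flow.

(** * Passage between the [sigma] metrics and their dual forms *)

Lemma ipsl_vec (R : realType) (n : nat) (X Y : mat R n) :
  ipsl X Y = (vec X *m (conjv (vec Y))^T) 0 0.
Proof.
rewrite conj_vec dotE ipslE; apply: eq_bigr => i _; apply: eq_bigr => j _.
by rewrite mxE.
Qed.

Lemma conj_traceless (R : realType) (n : nat) :
  conjv (traceless R n) = traceless R n.
Proof.
rewrite /traceless /conjv map_mxB map_mx1 map_mxZ map_mxM -map_trmx.
by rewrite -/(conjv (one_vec R n)) conj_one_vec /= conjc_inv conjc_nat.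
Qed.

Lemma bil_dual_gram_sigma (R : realType) (n : nat) (x y z : R)
    (h : mat R n -> mat R n -> R[i]) (X Y : mat R n) :
  (0 < n)%N -> x != 0 -> y != 0 -> z != 0 -> herm_ip h ->
  (forall X Y, in_sl X -> in_sl Y -> h X Y = ipsl (sigma x y z X) Y) ->
  in_sl X -> in_sl Y ->
  bil X Y (dual_gram h) = block_form (weight n x%:C y%:C z%:C) X Y.
Proof.
move=> n0 x0 y0 z0 hip hE Xsl Ysl.
have Zsl := in_sl_sigma n0 x^-1 y^-1 z^-1 Xsl.
have XE := sigmaK n0 x0 y0 z0 Xsl.
set Z := sigma x^-1 y^-1 z^-1 X in Zsl XE.
rewrite -XE block_form_sigma //.
(* With [X] written as [sigma] of [Z], this identity gives [vec X *m dual_gram h = vec Z], so the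
   dual form at [X] and [Y] is the dot product of [Z] and [Y]. *)
suff E : vec Z *m gram h = vec (sigma x y z Z).
  by rewrite /bil -E -[vec Z *m _ *m _]mulmxA (mul_gram_dual hip) mulmx1 dotE.
apply: row_eq_dot => u; rewrite -[u]conjvK; move: (conjv u) => v.
rewrite gramE // vecK Zsl mul0r mulr0 addr0.
rewrite traceless_id ?vecK // hE //; last exact: tr_unvec_traceless.
rewrite ipsl_vec unvecK conjvM conj_traceless trmx_mul traceless_tr mulmxA.
by rewrite traceless_id // vecK; exact: in_sl_sigma.
Qed.

Lemma herm_of_bil_dual_gram (R : realType) (n : nat) (x y z : R)
    (h : mat R n -> mat R n -> R[i]) :
  (0 < n)%N -> x != 0 -> y != 0 -> z != 0 -> herm_ip h ->
  (forall X Y, in_sl X -> in_sl Y ->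
    bil X Y (dual_gram h) = block_form (weight n x%:C y%:C z%:C) X Y) ->
  forall X Y, in_sl X -> in_sl Y -> h X Y = ipsl (sigma x y z X) Y.
Proof.
move=> n0 x0 y0 z0 hip hE X Y Xsl Ysl.
have Ssl := in_sl_sigma n0 x y z Xsl.
suff E : vec (sigma x y z X) *m dual_gram h = vec X.
  rewrite -(gram_sl hip) // -E -[_ *m dual_gram h *m _]mulmxA (mul_dual_gram hip).
  by rewrite mulmx1 ipsl_vec.
apply: row_eq_dot => u.
(* The hypothesis speaks of trace-zero matrices only; the component along the identity pairs to zero
   with both sides. *)
have [v [k [vsl ->]]] : exists v k, in_sl v /\ u = vec v + k *: one_vec R n.
  exists (unvec (u *m traceless R n)), (n.+1%:R^-1 * \tr (unvec u)).
  by split; [exact: tr_unvec_traceless|rewrite unvecK mul_traceless subrK].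
have dotD (w : 'rV[R[i]]_(n.+1 * n.+1)) : (w *m (vec v + k *: one_vec R n)^T) 0 0 =
    (w *m (vec v)^T) 0 0 + k * (w *m (one_vec R n)^T) 0 0.
  by rewrite linearD linearZ/= mulmxDr -scalemxAr !mxE.
rewrite !dotD -[_ *m dual_gram h *m (one_vec R n)^T]mulmxA (dual_gram_one hip) !dot1.
rewrite Ssl Xsl !mulr0 !addr0 -[LHS]/(bil _ _ _) hE //.
by rewrite block_form_sigma // dotE.
Qed.

Lemma quad_defect0 (R : realType) (n : nat) (M : 'M[R[i]]_(n.+1 * n.+1)) :
  defect M = 0 -> quad M M = quad (ansatz M) (ansatz M).
Proof.
move=> D0; have E : traceless R n *m M *m traceless R n =
    traceless R n *m ansatz M *m traceless R n.
  by apply/eqP; rewrite -subr_eq0 -mulmxBl -mulmxBr; apply/eqP.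
rewrite -quad_tracelessl -quad_tracelessr E.
by rewrite quad_tracelessl quad_tracelessr.
Qed.

Lemma block_form_neq0 (R : realType) (n : nat) c (X : mat R n) :
  block_form c X X = 1 -> X != 0.
Proof.
apply: contra_eq_neq => ->; rewrite /block_form big1 1?eq_sym ?oner_neq0 // => i _.
by rewrite big1 // => j _; rewrite mxE !mulr0.
Qed.

Theorem corollary3p2 (R : realType) (n : nat) (hn : (2 <= n)%N)
    (x0 y0 z0 : R) (hx0 : 0 < x0) (hy0 : 0 < y0) (hz0 : 0 < z0)
    (T : R) (hT : 0 < T) (h : R -> mat R n -> mat R n -> R[i])
    (hsol : PHCF_solution T (fun X Y => ipsl (sigma x0 y0 z0 X) Y) h) :
  exists x y z : R -> R,
    xyz_solution n T x0 y0 z0 x y z /\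
    forall t, 0 <= t < T -> forall X Y : mat R n, in_sl X -> in_sl Y ->
      h t X Y = ipsl (sigma (x t) (y t) (z t) X) Y.
Proof.
have n0 : (0 < n)%N by exact: ltn_trans hn.
pose M s := dual_gram (h s).
pose EX := unit_sln R n; pose EY := Imat R n; pose EZ := unit_s R n.
(* The candidates are the three values read by [ansatz]. Real parts are taken for the type; [pos]
   shows that the values are real and positive. *)
pose x s := complex.Re (bil EX EX (M s)).
pose y s := complex.Re (bil EY EY (M s)).
pose z s := complex.Re (bil EZ EZ (M s)).
have [hip h00 _ _] := hsol.
have M0 X Y : in_sl X -> in_sl Y -> bil X Y (M 0) =
    block_form (weight n x0%:C y0%:C z0%:C) X Y.
  by apply: bil_dual_gram_sigma; rewrite ?gt_eqF //; apply: hip; rewrite lexx.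
have cM p q : continuousC T (fun s => M s p q) by exact: (continuousC_dual_gram hsol).
have dM t : 0 < t < T -> forall p q,
    is_deriveC t (fun s => M s p q) (quad (M t) (M t) p q).
  by move=> t0T; exact: (is_deriveC_dual_gram hsol).
have D0 t : 0 <= t < T -> defect (M t) = 0.
  by apply: (defect_ode_eq0 hn) => //; exact: (defect_eq0 hn M0).
have slX : in_sl EX := in_sl_unit_sln R hn.
have slY : in_sl EY := in_sl_Imat R n.
have slZ : in_sl EZ := in_sl_unit_s R hn.
have pos t : 0 <= t < T -> [/\ 0 < bil EX EX (M t), 0 < bil EY EY (M t)
    & 0 < bil EZ EZ (M t)].
  move=> /hip ht; split; apply: bil_dual_gram_gt0 => //.
  - exact: (block_form_neq0 (block_form_unit_sln hn 1 1 1)).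
  - exact: map_delta_mx.
  - exact: (block_form_neq0 (block_form_Imat n0 1 1 1)).
  - by apply/matrixP => i j; rewrite mxE conj_Imat.
  - exact: (block_form_neq0 (block_form_unit_s hn 1 1 1)).
  - exact: map_delta_mx.
have posR (c : R[i]) : 0 < c -> 0 < complex.Re c /\ (complex.Re c)%:C = c.
  by rewrite ltcE; case: c => a b /= /andP[/eqP -> ->].
(* Zero defect means that on sl_{n+1} the dual form equals its ansatz, whose weights are [x t],
   [y t], [z t]. *)
have bilM t X Y : 0 <= t < T -> in_sl X -> in_sl Y ->
    bil X Y (M t) = block_form (weight n (x t)%:C (y t)%:C (z t)%:C) X Y.
  move=> tT Xsl Ysl; have [/posR[_ xE] /posR[_ yE] /posR[_ zE]] := pos t tT.
  rewrite /x xE /y yE /z zE; apply/eqP; rewrite -subr_eq0 -bil_defect //.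
  by rewrite (D0 t tT) linear0.
exists x, y, z; split; last first.
  move=> t tT; have [/posR[x_gt _] /posR[y_gt _] /posR[z_gt _]] := pos t tT.
  by apply: herm_of_bil_dual_gram; rewrite ?gt_eqF //; [exact: hip|move=> *; exact: bilM].
have cbil X Y : continuousC T (fun s => bil X Y (M s)).
  exact: (continuousC_scalar (@bil_is_scalar R n X Y)).
(* Evaluated at the three test matrices, this identity yields the three differential equations. *)
have quadM t X Y : 0 < t < T -> in_sl X -> in_sl Y -> bil X Y (quad (M t) (M t)) =
    block_form (weight n (n%:R * (x t)%:C ^+ 2 + (z t)%:C ^+ 2)
      (n.+1%:R * (z t)%:C ^+ 2)
      (n.+1%:R / n%:R * (z t)%:C * (n.-1%:R * (x t)%:C + (y t)%:C))) X Y.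
  move=> /andP[t0 tT] Xsl Ysl.
  have tT' : 0 <= t < T by rewrite ltW.
  have [/posR[_ xE] /posR[_ yE] /posR[_ zE]] := pos t tT'.
  by rewrite (quad_defect0 (D0 t tT')) quad_weight // /x xE /y yE /z zE.
have dbil t X Y : 0 < t < T ->
    is_deriveC t (fun s => bil X Y (M s)) (bil X Y (quad (M t) (M t))).
  move=> t0T; exact: (is_deriveC_scalar (@bil_is_scalar R n X Y) (dM t t0T)).
split.
- by move=> t tT; have [/posR[? _] /posR[? _] /posR[? _]] := pos t tT.
- rewrite /x /y /z !M0 //.
  by rewrite block_form_unit_sln // block_form_Imat // block_form_unit_s.
- by split; [have [] := cbil EX EX|have [] := cbil EY EY|have [] := cbil EZ EZ].
- move=> t t0T; split.
  + have [+ _] := dbil t EX EX t0T.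
    rewrite quadM // block_form_unit_sln // => d.
    apply: (is_derive_eq d).
    by rewrite -!rmorphXn -(rmorph_nat (real_complex R)) -rmorphM -rmorphD.
  + have [+ _] := dbil t EY EY t0T.
    rewrite quadM // block_form_Imat // => d.
    apply: (is_derive_eq d).
    by rewrite -!rmorphXn -(rmorph_nat (real_complex R)) -rmorphM.
  + have [+ _] := dbil t EZ EZ t0T.
    rewrite quadM // block_form_unit_s // => d.
    apply: (is_derive_eq d).
    by rewrite -!(rmorph_nat (real_complex R)) -fmorphV -!rmorphM -rmorphD -!rmorphM.
Qed.
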